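(* Let $t_0<t_1$, $0<a<b<1$, $a_0\in\mathbb{R}$, and let $\alpha:\mathbb{R}\to[a,b]$ be continuously differentiable with bounded derivative. Let $\Pi\subset(t_0,t_1)\times\mathbb{R}$ be a Poisson point process with plane Lebesgue measure $\mathcal{L}^2$ (restricted to $(t_0,t_1)\times\mathbb{R}$) as mean measure. Then there exists a Markov process $Z$ on $[t_0,t_1)$ such that, almost surely, the sample paths are in $D[t_0,t_1)$ with $Z(t_0)=a_0$ and $$Z(t)=a_0+\sum_{(X,Y)\in\Pi}1_{(t_0,t]}(X)\,Y^{\langle-1/\alpha(Z(X_-))\rangle}\qquad(t_0\le t<t_1).$$ Writing, for $n\in\mathbb{N}$, $$Z_n(t)=a_0+\sum_{(X,Y)\in\Pi:\,|Y|\le n}1_{(t_0,t]}(X)\,Y^{\langle-1/\alpha(Z_n(X_-))\rangle}\qquad(t_0\le t<t_1),$$ then almost surely $\|Z_n-Z\|_\infty\to0$ as $n\to\infty$.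
   Context: $D[t_0,t_1)$ denotes the càdlàg functions $f:[t_0,t_1)\to\mathbb{R}$: $f$ is right continuous at every $u\in[t_0,t_1)$, and the left limit $f(u_-):=\lim_{t\nearrow u}f(t)$ exists (and is finite) for every $u\in(t_0,t_1]$, including at $u=t_1$. $\|\cdot\|_\infty$ is the supremum norm over $[t_0,t_1)$. For real $r,s$ write $r^{\langle s\rangle}=\mathrm{sign}(r)|r|^s$. A Poisson point process with mean measure $\mu$ is a random countable set $\Pi$ such that for each Borel set $A$ the number of points $N(A)$ of $\Pi$ in $A$ is a random variable having Poisson distribution with mean $\mu(A)$, independently for disjoint Borel sets. The process $Z$ is defined on the probability space of $\Pi$. Almost surely only finitely many points of $\Pi$ have $|Y|\le n$, so $Z_n$ is the piecewise constant function determined inductively over the successive jump points. *)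

(* Defs.v *)
From HB Require Import structures.
From mathcomp Require Import all_boot all_order all_algebra.
From mathcomp Require Import all_classical all_reals all_analysis.
From mathcomp Require Import measurable_realfun.

Set Implicit Arguments.
Unset Strict Implicit.
Unset Printing Implicit Defensive.

Import Order.TTheory GRing.Theory Num.Theory.
Import numFieldNormedType.Exports.

Local Open Scope classical_set_scope.
Local Open Scope ring_scope.

(** * Poisson point processes *)

(* [poisson_prob] carries an unused [nat] argument, instantiated by [0%N] here;
   at rate 0 it is the Dirac mass at 0 (whereas [poisson_pmf 0 k = 1] for all
   [k]).  A Poisson variable of infinite mean is almost surely infinite. *)
Definition poisson_law d (T : measurableType d) (R : realType)
    (P : probability T R) (N : T -> \bar R) (m : \bar R) : Prop :=
  match m with
  | r%:E => forall k : nat,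
      P [set w | N w = k%:R%:E] = poisson_prob r 0%N [set k]
  | _ => P [set w | N w = +oo%E] = 1%E
  end.

Definition point_count d (T : measurableType d) (R : realType)
    d' (E : measurableType d') (Pi : T -> set E) (A : set E) (w : T) : \bar R :=
  @counting E R (Pi w `&` A).

Definition poisson_point_process d (T : measurableType d) (R : realType)
    (P : probability T R) d' (E : measurableType d')
    (mu : set E -> \bar R) (Pi : T -> set E) : Prop :=
  [/\ forall w, countable (Pi w),
      forall A, measurable A ->
        measurable_fun setT (point_count R Pi A) /\
        poisson_law P (point_count R Pi A) (mu A) &
      forall (m : nat) (A : 'I_m -> set E) (B : 'I_m -> set (\bar R)),
        (forall i, measurable (A i)) -> trivIset setT A ->
        (forall i, measurable (B i)) ->
        P (\bigcap_(i in setT) (point_count R Pi (A i) @^-1` B i)) =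
        (\prod_(i < m) P (point_count R Pi (A i) @^-1` B i))%E].

Definition strip (R : realType) (t0 t1 : R) :
    set (measurableTypeR R * measurableTypeR R) :=
  `]t0, t1[%classic `*` setT.

Definition lebesgue_strip (R : realType) (t0 t1 : R)
    (A : set (measurableTypeR R * measurableTypeR R)) : \bar R :=
  (@lebesgue_measure R \x @lebesgue_measure R)%E (A `&` strip t0 t1).

(** * Markov processes *)

Definition sigma_rv d (T : measurableType d) (R : realType)
    (D : set R) (Z : R -> T -> R) : set (set T) :=
  <<s \bigcup_(u in D) preimage_set_system setT (Z u) measurable >>.

(* [h] is a version of the conditional probability [P (E | G)]. *)
Definition is_cond_prob d (T : measurableType d) (R : realType)
    (P : probability T R) (G : set (set T)) (E : set T) (h : T -> R) : Prop :=
  [/\ forall B : set R, measurable B -> G (h @^-1` B),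
      P.-integrable setT (EFin \o h) &
      forall A, G A -> (\int[P]_(w in A) (h w)%:E)%E = P (A `&` E)].

(* Markov property for the natural filtration:
   P(Z_t \in B | Z_u, u <= s) = P(Z_t \in B | Z_s) almost surely, i.e. the two
   conditional probabilities have a common version. *)
Definition markov_process d (T : measurableType d) (R : realType)
    (P : probability T R) (D : set R) (Z : R -> T -> R) : Prop :=
  (forall t, D t -> measurable_fun setT (Z t)) /\
  (forall s t (B : set R), D s -> D t -> s <= t -> measurable B ->
    exists h : T -> R,
      is_cond_prob P (sigma_rv (D `&` [set u | u <= s]) Z) (Z t @^-1` B) h /\
      is_cond_prob P (sigma_rv [set s] Z) (Z t @^-1` B) h).

(** * Càdlàg functions and the jump equation *)

Definition left_limit (R : realType) (f : R -> R) (u : R) : R :=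
  lim (f x @[x --> u^'-]).

(* Functions on [t0, t1) are represented by total functions whose values
   outside [t0, t1) are irrelevant. *)
Definition cadlag (R : realType) (t0 t1 : R) (f : R -> R) : Prop :=
  (forall u, t0 <= u < t1 -> f x @[x --> u^'+] --> f u) /\
  (forall u, t0 < u <= t1 -> cvg (f x @[x --> u^'-])).

Definition sup_norm (R : realType) (t0 t1 : R) (f : R -> R) : \bar R :=
  ereal_sup [set (`|f t|)%:E | t in `[t0, t1[%classic].

(* r^<s> = sign(r) |r|^s *)
Definition signed_pow (R : realType) (r s : R) : R :=
  Num.sg r * `|r| `^ s.

Definition jump_term (R : realType) (t0 : R) (alpha f : R -> R) (t : R)
    (p : R * R) : \bar R :=
  (\1_(`]t0, t]%classic) p.1 *
   signed_pow p.2 (- (alpha (left_limit f p.1))^-1))%:E.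

(* The sum over the (unordered, countable) set [S] is required to converge
   absolutely; its value is the sum of the positive parts minus the sum of the
   negative parts. *)
Definition jump_equation (R : realType) (t0 t1 a0 : R) (alpha : R -> R)
    (S : set (R * R)) (f : R -> R) : Prop :=
  forall t, t0 <= t < t1 ->
    let g := jump_term t0 alpha f t in
    summable S g /\
    ((f t)%:E = a0%:E + (\esum_(p in S) g^\+ p - \esum_(p in S) g^\- p))%E.

(* Main.v *)
Require Import Defs.
From HB Require Import structures.
From mathcomp Require Import all_boot all_order all_algebra.
From mathcomp Require Import all_classical all_reals all_analysis.
From mathcomp Require Import measurable_realfun.
From mathcomp Require Import ring lra zify.

Set Implicit Arguments.
Unset Strict Implicit.
Unset Printing Implicit Defensive.

Import Order.TTheory GRing.Theory Num.Theory.
Import numFieldNormedType.Exports.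

Local Open Scope classical_set_scope.
Local Open Scope ring_scope.

(** The equation is solved path by path. Write F(y, z) for the amplitude
    y^<-1/alpha(z)>. Since 1/alpha stays between 1/b > 1 and 1/a, there is an
    explicit D(y), decreasing in |y| and integrable at infinity, which bounds
    both |F(y, z)| and the Lipschitz constant of F(y, .)
    ([amplitude_majorant]). Comparison with dyadic discs, in which the mean
    number of points is proportional to the radius, shows that the sum of D over
    the points is almost surely finite ([poisson_summable]); from there on the
    configuration is a fixed sequence of jump times x_i and marks y_i with
    summable D(y_i).

    For such a sequence the jump equation is equivalent to a system for the left
    limits z_i = Z(x_i -), namely z_i = a0 + sum_{x_j < x_i} F(y_j, z_j). For a
    suitable weight the associated operator is a contraction of ratio 1/2
    ([jump_weight]). This yields a Gronwall inequality, existence by Picard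
    iteration ([jump_solution_exists]) and a bound of the distance between two
    solutions by the sum of the differences of the amplitudes
    ([jump_stability]). Discarding the marks beyond n changes the amplitudes by
    a tail of the summable majorant, hence the uniform convergence of Z_n
    ([truncation_cvg]), whatever solutions Z_n are considered.

    Measurability and the Markov property come from an Euler scheme that uses
    only the events that a box contains a point of the process. The number of
    points in a box may be ignored, because points are eventually separated by
    the boxes and the total contribution of the others is dominated.
    Started at time s from Z(s) and driven by the points in ]s, t], the scheme
    converges to Z(t) for almost every configuration ([cvg_euler],
    [flow_jump_path]). So Z is defined as the upper limit of the scheme, and Z(t)
    is a measurable function of Z(s) and of the avoidance events of the sets
    located after s. The events {no point in A} are stable under intersection,
    since avoiding A and B is avoiding their union; therefore independence over
    disjoint sets extends, by the pi-lambda theorem, to the independence of the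
    sigma-algebras of past and future avoidance events ([past_future_indep]).
    Integrating out the future with the state frozen ([indep_freezing]) gives a
    version of the conditional probability given the past which depends on Z(s)
    only ([transition_cond_prob]). *)

(** * Dominated sums of real sequences *)

Section Sums.
Context {R : realType}.
Implicit Types (u v D : nat -> R).

Definition asum u : Prop := cvgn (series (fun i => `|u i|)).
Definition rsum u : R := limn (series u).

Lemma asum_cvg u : asum u -> cvgn (series u).
Proof. exact: normed_cvg. Qed.

Lemma asum_le v u : asum v -> (forall i, `|u i| <= `|v i|) -> asum u.
Proof. by move=> av uv; apply: series_le_cvg av. Qed.

Lemma asumD u v : asum u -> asum v -> asum (fun i => u i + v i).
Proof.
move=> au av; apply: (@series_le_cvg _ _ (fun i => `|u i| + `|v i|)) => //.
- by move=> n; exact: ler_normD.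
- exact: (is_cvg_seriesD au av).
Qed.

Lemma asumN u : asum u -> asum (fun i => - u i).
Proof. by move=> au; apply: asum_le au _ => i; rewrite normrN. Qed.

Lemma asumB u v : asum u -> asum v -> asum (fun i => u i - v i).
Proof. by move=> au av; apply: asumD => //; exact: asumN. Qed.

Lemma asumZ c u : asum u -> asum (fun i => c * u i).
Proof.
move=> au; apply: (@series_le_cvg _ _ (fun i => `|c| * `|u i|)) => //.
- by move=> n; rewrite normrM.
- by have := @is_cvg_seriesZ _ _ `|c| au.
Qed.

Lemma rsumD u v : asum u -> asum v ->
  rsum (fun i => u i + v i) = rsum u + rsum v.
Proof. by move=> /asum_cvg au /asum_cvg av; rewrite -lim_seriesD. Qed.

Lemma rsumB u v : asum u -> asum v ->
  rsum (fun i => u i - v i) = rsum u - rsum v.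
Proof. by move=> /asum_cvg au /asum_cvg av; rewrite -lim_seriesB. Qed.

Lemma rsumZ c u : asum u -> rsum (fun i => c * u i) = c * rsum u.
Proof. by move=> /asum_cvg au; have := lim_seriesZ c au. Qed.

Lemma ler_rsum u v : asum u -> asum v -> (forall i, u i <= v i) ->
  rsum u <= rsum v.
Proof. by move=> /asum_cvg au /asum_cvg av; exact: lim_series_le. Qed.

Lemma ler_norm_rsum u v : asum v -> (forall i, `|u i| <= v i) ->
  `|rsum u| <= rsum v.
Proof.
move=> av uv; have au : asum u.
  by apply: asum_le av _ => i; exact: le_trans (uv i) (ler_norm _).
by apply: le_trans (lim_series_norm au) _; apply: lim_series_le => //;
  exact: asum_cvg.
Qed.

Lemma eq_rsum u v : u =1 v -> rsum u = rsum v.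
Proof. by move=> /funext ->. Qed.

Lemma eq_asum u v : u =1 v -> asum u -> asum v.
Proof. by move=> /funext ->. Qed.

Lemma series_cst0 : series (fun=> 0 : R) = fun=> 0.
Proof. by apply/funext => n; rewrite /series /= big1. Qed.

Lemma asum0 : asum (fun=> 0).
Proof.
rewrite /asum; under eq_fun do rewrite normr0.
by rewrite series_cst0; exact: is_cvg_cst.
Qed.

Lemma rsum0 : rsum (fun=> 0) = 0.
Proof. by rewrite /rsum series_cst0 lim_cst. Qed.

Lemma rsum_ge0 u : asum u -> (forall i, 0 <= u i) -> 0 <= rsum u.
Proof. by move=> au u0; rewrite -rsum0; apply: ler_rsum => //; exact: asum0. Qed.

Lemma series_le_rsum u n : asum u -> (forall i, 0 <= u i) ->
  series u n <= rsum u.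
Proof.
move=> /asum_cvg au u0; apply: nondecreasing_cvgn_le => //.
exact: nondecreasing_series.
Qed.

Lemma rsum_le_bound u c : asum u -> (forall n, series u n <= c) -> rsum u <= c.
Proof. by move=> /asum_cvg au uc; apply: limr_le => //; exact: nearW. Qed.

Lemma asum_sum (I : Type) (r : seq I) (f : I -> nat -> R) :
  (forall b, asum (f b)) -> asum (fun i => \sum_(b <- r) f b i).
Proof.
move=> af; elim: r => [|b r IH].
  by apply: eq_asum asum0 => i; rewrite big_nil.
by apply: eq_asum (asumD (af b) IH) => i; rewrite big_cons.
Qed.

Lemma rsum_sum (I : Type) (r : seq I) (f : I -> nat -> R) :
  (forall b, asum (f b)) ->
  rsum (fun i => \sum_(b <- r) f b i) = \sum_(b <- r) rsum (f b).
Proof.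
move=> af; elim: r => [|b r IH].
  by rewrite big_nil -[RHS]rsum0; apply: eq_rsum => i; rewrite big_nil.
rewrite big_cons -IH -rsumD//; last exact: asum_sum.
by apply: eq_rsum => i; rewrite big_cons.
Qed.

Lemma series_single (k : nat) (c : R) n : (k < n)%N ->
  series (fun i => (i == k)%:R * c) n = c.
Proof.
move=> kn; rewrite seriesEord /= (bigD1 (Ordinal kn))//= eqxx mul1r big1 ?addr0//.
by move=> i /eqP ik; rewrite (_ : (i == k :> nat) = false) ?mul0r//;
  apply/eqP => e; apply: ik; exact: val_inj.
Qed.

Lemma cvg_series_single (k : nat) (c : R) : series (fun i => (i == k)%:R * c) @ \oo --> c.
Proof.
apply: cvg_near_cst; near=> n; rewrite series_single//.
by near: n; exact: nbhs_infty_gt.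
Unshelve. all: by end_near. Qed.

Lemma asum_single (k : nat) (c : R) : asum (fun i => (i == k)%:R * c).
Proof.
rewrite /asum; under eq_fun do rewrite normrM normr_nat.
apply/cvg_ex; exists `|c|; exact: cvg_series_single.
Qed.

Lemma rsum_single (k : nat) (c : R) : rsum (fun i => (i == k)%:R * c) = c.
Proof. by apply: cvg_lim => //; exact: cvg_series_single. Qed.

Lemma rsum_tail u D n : asum D -> (forall i, `|u i| <= D i) ->
  `|rsum u - series u n| <= rsum D - series D n.
Proof.
move=> aD uD; have au : asum u.
  by apply: asum_le aD _ => i; exact: le_trans (uD i) (ler_norm _).
have cu := asum_cvg au; have cD := asum_cvg aD.
have c1 : `|series u m - series u n| @[m --> \oo] --> `|rsum u - series u n|.
  by apply: cvg_norm; apply: cvgB => //; exact: cvg_cst.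
have c2 : series D m - series D n @[m --> \oo] --> rsum D - series D n.
  by apply: cvgB => //; exact: cvg_cst.
apply: (ler_cvg_to c1 c2); near=> m.
have nm : (n <= m)%N by near: m; exact: nbhs_infty_ge.
rewrite !sub_series_geq//.
by apply: le_trans (ler_norm_sum _ _ _) _; exact: ler_sum.
Unshelve. all: by end_near. Qed.

(** Tannery's theorem, that is dominated convergence for series, along an
    arbitrary filter: the tails are uniformly small by domination, and finite
    sums pass to the limit. *)
Lemma tannery (T : Type) (F : set_system T) {FF : ProperFilter F}
    (u : T -> nat -> R) v D : asum D ->
  (\forall t \near F, forall i, `|u t i| <= D i) ->
  (forall i, u t i @[t --> F] --> v i) ->
  rsum (u t) @[t --> F] --> rsum v.
Proof.
move=> aD uD uv.
have vD i : `|v i| <= D i.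
  have h1 : `|u t i| @[t --> F] --> `|v i| by apply: cvg_norm; exact: uv.
  by apply: (cvgr_to_le h1); apply: filterS uD => t /(_ i).
apply/cvgrPdist_le => e e0.
have [n Dn] : exists n, rsum D - series D n <= e / 4.
  have /cvgrPdist_le/(_ _ (divr_gt0 e0 (ltr0n _ 4))) : series D @ \oo --> rsum D.
    exact: asum_cvg.
  move=> [n _ /(_ n (leqnn n)) h]; exists n.
  exact: le_trans (ler_norm _) h.
have cs : series (u t) n @[t --> F] --> series v n.
  rewrite /series /=.
  by apply: cvg_big => [|i _]; [exact: add_continuous|exact: uv].
near=> t.
have h1 : `|rsum (u t) - series (u t) n| <= e / 4.
  by apply: le_trans Dn; apply: rsum_tail => //; near: t.
have h2 : `|rsum v - series v n| <= e / 4.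
  by apply: le_trans Dn; apply: rsum_tail.
have h3 : `|series v n - series (u t) n| <= e / 4.
  by near: t; move/cvgrPdist_le : cs; apply; rewrite divr_gt0.
have -> : rsum v - rsum (u t) = (rsum v - series v n) +
  (series v n - series (u t) n) - (rsum (u t) - series (u t) n) by ring.
apply: le_trans (ler_normB _ _) _.
apply: le_trans (lerD (ler_normD _ _) (lexx _)) _.
apply: le_trans (lerD (lerD h2 h3) h1) _; lra.
Unshelve. all: by end_near. Qed.

End Sums.

Arguments asumZ {R} c [u] _.
(** * Systems of jumps with dominated Lipschitz amplitudes *)

Section Mask.
Context {R : realType}.
Implicit Types (b : nat -> bool) (u v D : nat -> R).

Lemma mask_le (c : bool) (r : R) : `|c%:R * r| <= `|r|.
Proof. by case: c; rewrite ?mul1r// mul0r normr0. Qed.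

Lemma asum_mask b u : asum u -> asum (fun j => (b j)%:R * u j).
Proof. by move=> au; apply: asum_le au _ => i; exact: mask_le. Qed.

Lemma ler_rsum_mask b D : asum D -> (forall i, 0 <= D i) ->
  rsum (fun j => (b j)%:R * D j) <= rsum D.
Proof.
move=> aD D0; apply: ler_rsum => //; first exact: asum_mask.
by move=> i; case: (b i); rewrite ?mul1r ?mul0r.
Qed.

Lemma ler_norm_rsum_mask b u D : asum D -> (forall i, `|u i| <= D i) ->
  `|rsum (fun j => (b j)%:R * u j)| <= rsum (fun j => (b j)%:R * D j).
Proof.
move=> aD uD; apply: ler_norm_rsum; first exact: asum_mask.
by move=> i; rewrite normrM normr_nat ler_wpM2l.
Qed.

End Mask.

Section JumpSystem.
Context {R : realType}.
Variables (x D : nat -> R).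
Hypotheses (D0 : forall i, 0 <= D i) (aD : asum D).

(** An upper bound, explicit and independent of the order of the jumps, for the
    solution of Y(t) = 1 + sum_{j < n, x_j < t} 2 D_j Y(x_j). *)
Let weight n (t : R) := \prod_(j < n) (1 + (x j < t)%R%:R * (2 * D j)).

Let weight_ge1 n t : 1 <= weight n t.
Proof.
rewrite /weight; elim/big_rec : _ => // j y _ y1.
apply: (le_trans y1); rewrite ler_peMl//; first exact: le_trans ler01 y1.
by rewrite lerDl mulr_ge0// mulr_ge0.
Qed.

Let weightS n t : weight n.+1 t = weight n t * (1 + (x n < t)%R%:R * (2 * D n)).
Proof. by rewrite /weight big_ord_recr. Qed.

(** Adding the jump [n] multiplies the weight by [1 + 2 D n] after time [x n]
    only; splitting the sum at [x n] gives two instances of the induction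
    hypothesis, started from [s] and from [x n]. *)
Let weight_step n s t : s <= t ->
  weight n s + \sum_(j < n) (s <= x j < t)%R%:R * (2 * D j * weight n (x j))
  <= weight n t.
Proof.
elim: n s t => [|n IH] s t st; first by rewrite /weight !big_ord0 addr0.
have Dn0 : 0 <= 2 * D n by rewrite mulr_ge0.
rewrite big_ord_recr /= !weightS ltxx mul0r addr0 mulr1.
have [xs|sx] := ltP (x n) s.
  rewrite (lt_le_trans xs st) /= mul0r addr0 mul1r.
  rewrite (_ : \sum_(j < n) _ = (\sum_(j < n) (s <= x j < t)%R%:R *
    (2 * D j * weight n (x j))) * (1 + 2 * D n)); last first.
    rewrite mulr_suml; apply: eq_bigr => j _; rewrite weightS.
    have [sj|] := boolP (s <= x j); last by rewrite /= !mul0r.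
    by rewrite (lt_le_trans xs sj) mul1r !mulrA.
  by rewrite -mulrDl ler_wpM2r ?addr_ge0//; exact: IH.
have [xt|tx] := ltP (x n) t; last first.
  rewrite /= !mul0r addr0 !mulr1 addr0.
  rewrite (_ : \sum_(j < n) _ = \sum_(j < n) (s <= x j < t)%R%:R *
    (2 * D j * weight n (x j))); first exact: IH.
  apply: eq_bigr => j _; rewrite weightS.
  have [jt|] := ltP (x j) t; last by rewrite andbF !mul0r.
  by rewrite ltNge (ltW (lt_le_trans jt tx)) /= mul0r addr0 mulr1.
rewrite /= mul0r addr0 mulr1 !mul1r.
apply: (@le_trans _ _ ((weight n s + \sum_(j < n) (s <= x j < t)%R%:R *
    (2 * D j * weight n (x j))) + 2 * D n * (weight n (x n) +
    \sum_(j < n) (x n <= x j < t)%R%:R * (2 * D j * weight n (x j))))); last first.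
  rewrite [X in _ <= X]mulrDr mulr1 [weight n t * _]mulrC lerD ?IH// ler_wpM2l//.
  by apply: IH; exact: ltW.
suff h : \sum_(j < n) (s <= x j < t)%R%:R * (2 * D j * weight n.+1 (x j)) <=
    \sum_(j < n) (s <= x j < t)%R%:R * (2 * D j * weight n (x j)) +
    2 * D n * \sum_(j < n) (x n <= x j < t)%R%:R * (2 * D j * weight n (x j)).
  by rewrite mulrDr; lra.
rewrite mulr_sumr -big_split /= ler_sum// => j _.
rewrite weightS.
have := weight_ge1 n (x j) => /(le_trans ler01) W0.
have Dj0 := D0 j.
have [jt|] := ltP (x j) t; last by rewrite !andbF !mul0r mulr0 addr0.
have [nj|jn] := ltP (x n) (x j).
  rewrite (le_trans sx (ltW nj)) (ltW nj) /= !mul1r.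
  by rewrite le_eqVlt; apply/orP; left; apply/eqP; ring.
rewrite mul0r addr0 mulr1 lerDl.
by rewrite !mulr_ge0.
Qed.

Let C := expR (2 * rsum D).

Let weight_le n t : weight n t <= C.
Proof.
have h : weight n t <= expR (2 * series D n).
  elim: n => [|n IH].
    by rewrite /weight big_ord0 seriesEord /= big_ord0 mulr0 expR0.
  rewrite weightS seriesSr [2 * (_ + _)]mulrDr expRD ler_pM//.
  - exact: le_trans ler01 (weight_ge1 _ _).
  - by rewrite addr_ge0// mulr_ge0// mulr_ge0.
  apply: le_trans (expR_ge1Dx _); rewrite lerD2l.
  by case: (_ < _); rewrite ?mul1r// mul0r mulr_ge0.
apply: (le_trans h); rewrite ler_expR ler_wpM2l//; exact: series_le_rsum.
Qed.

(** A Bielecki weight: integration of [V] against the jumps halves it, so that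
    the integral operators below contract for the norm weighted by [V]. *)
Lemma jump_weight : exists V : R -> R, [/\ forall t, 1 <= V t,
  forall t, V t <= expR (2 * rsum D) &
  forall t, rsum (fun j => (x j < t)%R%:R * (D j * V (x j))) <= V t / 2].
Proof.
have nd t : nondecreasing_seq (weight ^~ t).
  apply/nondecreasing_seqP => n; rewrite weightS ler_peMr//.
    exact: le_trans ler01 (weight_ge1 _ _).
  by rewrite lerDl mulr_ge0// mulr_ge0.
have cw t : cvgn (weight ^~ t).
  apply: nondecreasing_is_cvgn; first exact: nd.
  by exists C => _ [n _ <-]; exact: weight_le.
pose V t := limn (weight ^~ t).
have V1 t : 1 <= V t by apply: limr_ge => //; exact: nearW.
have VC t : V t <= C.
  by apply: limr_le => //; apply: nearW => n; exact: weight_le.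
have aDV : asum (fun j => D j * V (x j)).
  apply: asum_le (asumZ C aD) _ => i.
  have V0 := le_trans ler01 (V1 (x i)).
  by rewrite mulrC !normrM ler_wpM2r// !ger0_norm ?expR_ge0.
exists V; split => // t; apply: rsum_le_bound => [|N]; first exact: asum_mask.
have c1 : \sum_(j < N) (x j < t)%R%:R * (D j * weight n (x j)) @[n --> \oo] -->
    \sum_(j < N) (x j < t)%R%:R * (D j * V (x j)).
  apply: cvg_big => [|j _]; first exact: add_continuous.
  by apply: cvgMr; apply: cvgMr; exact: cw.
have c2 : weight n t / 2 @[n --> \oo] --> V t / 2.
  by apply: cvgMl; exact: cw.
rewrite seriesEord /=; apply: (ler_cvg_to c1 c2); near=> n.
have Nn : (N <= n)%N by near: n; exact: nbhs_infty_ge.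
(* Starting before every jump removes the lower constraint [s <= x j]. *)
pose s := \big[Num.min/t]_(j < n) x j.
have st : s <= t by exact: bigmin_le_id.
have := weight_step n st.
have W0 k r : 0 <= weight k r by exact: le_trans ler01 (weight_ge1 _ _).
move=> h; rewrite ler_pdivlMr// mulrC.
apply: le_trans h; apply: (@le_trans _ _ (\sum_(j < n)
    (s <= x j < t)%R%:R * (2 * D j * weight n (x j)))); last by rewrite lerDr.
pose g j := (s <= x j < t)%R%:R * (2 * D j * weight n (x j)).
rewrite -(big_mkord xpredT g) (big_cat_nat (leq0n N) Nn)//= big_mkord.
apply: ler_wpDr.
  by apply: sumr_ge0 => j _; rewrite /g !mulr_ge0.
rewrite mulr_sumr ler_sum// => j _; rewrite /g.
have -> : (s <= x j) = true.
  exact: (bigmin_le_cond _ (j := widen_ord Nn j)).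
by rewrite /= mulrCA ler_wpM2l// mulrA.
Unshelve. all: by end_near. Qed.

(** The supremum of [u / V] is at most [e] plus half of itself. *)
Lemma jump_gronwall (u : nat -> R) (B e : R) : 0 <= e ->
  (forall i, 0 <= u i <= B) ->
  (forall i, u i <= e + rsum (fun j => (x j < x i)%R%:R * (D j * u j))) ->
  forall i, u i <= expR (2 * rsum D) * (2 * e).
Proof.
move=> e0 uB ue; have [V [V1 VC VD]] := jump_weight.
have V0 t : 0 < V t by exact: lt_le_trans ltr01 (V1 t).
pose A := [set u i / V (x i) | i in setT].
have ubA : has_ubound A.
  exists B => _ [i _ <-]; have /andP[u0 uiB] := uB i.
  by rewrite ler_pdivrMr//; apply: (le_trans uiB); rewrite ler_peMr//
    (le_trans u0).
have Si i : u i <= sup A * V (x i).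
  by rewrite -ler_pdivrMr//; apply: ub_le_sup => //; exists i.
have aDV : asum (fun j => D j * V (x j)).
  apply: asum_le (asumZ (expR (2 * rsum D)) aD) _ => i.
  by rewrite mulrC !normrM ler_wpM2r// !ger0_norm ?expR_ge0// ltW.
have S0 : 0 <= sup A.
  have /andP[u0 _] := uB 0%N.
  by have := le_trans u0 (Si 0%N); rewrite pmulr_lge0.
have aDu : asum (fun j => D j * u j).
  apply: asum_le (asumZ (sup A) aDV) _ => i.
  have /andP[u0 _] := uB i.
  rewrite !normrM mulrCA ler_wpM2l// -normrM ger0_norm//.
  by rewrite (le_trans (Si i))// ler_norm.
have S2 : sup A <= e + sup A / 2.
  apply: ge_sup; first by exists (u 0%N / V (x 0%N)), 0%N.
  move=> _ [i _ <-]; rewrite ler_pdivrMr//; apply: (le_trans (ue i)).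
  rewrite mulrDl lerD//; first by rewrite ler_peMr.
  apply: (@le_trans _ _ (rsum (fun j => sup A *
      ((x j < x i)%R%:R * (D j * V (x j)))))); last first.
    rewrite rsumZ; last exact: asum_mask.
    by rewrite -mulrA [_^-1 * _]mulrC ler_wpM2l.
  apply: ler_rsum; first exact: asum_mask.
    by apply: asumZ; exact: asum_mask.
  by move=> j; rewrite [leRHS]mulrCA ler_wpM2l// [leRHS]mulrCA ler_wpM2l.
have S2e : sup A <= 2 * e by lra.
move=> i; apply: (le_trans (Si i)); rewrite mulrC ler_pM// ltW//.
Qed.

Variable F : nat -> R -> R.
Hypotheses (FD : forall i z, `|F i z| <= D i)
  (FL : forall i z z', `|F i z - F i z'| <= D i * `|z - z'|).

(** The unknowns are the left limits [z i] of the path at the jump times [x i]: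
    they form a closed system, which needs neither an ordering of the jump times
    (they may accumulate everywhere) nor any regularity of the path. *)
Definition jump_solution (G : nat -> R -> R) a0 (z : nat -> R) :=
  forall i, z i = a0 + rsum (fun j => (x j < x i)%R%:R * G j (z j)).

Definition jump_path (G : nat -> R -> R) a0 (z : nat -> R) t :=
  a0 + rsum (fun j => (x j <= t)%R%:R * G j (z j)).

Lemma asum_jump (G : nat -> R -> R) (z : nat -> R) :
  (forall i z, `|G i z| <= D i) -> asum (fun j => G j (z j)).
Proof.
by move=> GD; apply: asum_le aD _ => i; exact: le_trans (GD _ _) (ler_norm _).
Qed.

(** Picard iteration contracts for the norm weighted by [V]. *)
Lemma jump_solution_exists a0 : exists z, jump_solution F a0 z.
Proof.
have [V [V1 VC VD]] := jump_weight.
have V0 t : 0 < V t by exact: lt_le_trans ltr01 (V1 t).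
pose T (z : nat -> R) i := a0 + rsum (fun j => (x j < x i)%R%:R * F j (z j)).
pose z k := iter k T (fun=> a0).
pose L := rsum D.
have L0 : 0 <= L by exact: rsum_ge0.
have aDV : asum (fun j => D j * V (x j)).
  apply: asum_le (asumZ (expR (2 * rsum D)) aD) _ => i.
  by rewrite mulrC !normrM ler_wpM2r// !ger0_norm ?expR_ge0// ltW.
have zz k i : `|z k.+1 i - z k i| <= L * 2^-1 ^+ k * V (x i).
  elim: k i => [|k IH] i.
    rewrite /z /= /T addrAC subrr add0r expr0 mulr1.
    apply: (le_trans (ler_norm_rsum_mask _ aD (fun i => FD i _))).
    by apply: (le_trans (ler_rsum_mask _ aD D0)); rewrite ler_peMr.
  rewrite /z /= /T opprD addrACA subrr add0r -/(z k.+1) -/(z k).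
  have zF m : asum (fun j => (x j < x i)%R%:R * F j (z m j)).
    by apply: asum_mask; exact: asum_jump.
  rewrite -rsumB; [|exact: (zF k.+1)|exact: (zF k)].
  apply: (@le_trans _ _ (rsum (fun j => L * 2^-1 ^+ k *
     ((x j < x i)%R%:R * (D j * V (x j)))))).
    apply: ler_norm_rsum; first by apply: asumZ; exact: asum_mask.
    move=> j; rewrite -mulrBr normrM normr_nat mulrCA ler_wpM2l//.
    apply: (le_trans (FL _ _ _)); rewrite [leRHS]mulrCA ler_wpM2l//; exact: IH.
  rewrite rsumZ; last exact: asum_mask.
  rewrite exprSr mulrA -[_ * 2^-1 * _]mulrA [2^-1 * _]mulrC ler_wpM2l//.
    by rewrite mulr_ge0// exprn_ge0.
have cz i : cvgn (z ^~ i).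
  have -> : z ^~ i = fun n => z 0%N i + series (fun k => z k.+1 i - z k i) n.
    apply/funext => n; rewrite seriesEnat /=.
    by rewrite (telescope_sumr (z ^~ i))// addrC subrK.
  apply: is_cvgD; first exact: is_cvg_cst.
  apply: asum_cvg.
  apply: (@asum_le _ (fun k => L * V (x i) * 2^-1 ^+ k)).
    apply: asumZ; apply: (@eq_asum _ (geometric 1 2^-1)).
      by move=> k; rewrite /= mul1r.
    rewrite /asum (_ : (fun k => _) = geometric 1 2^-1).
      by apply: is_cvg_geometric_series; rewrite ger0_norm// invf_lt1// ltr1n.
    by apply/funext => k; rewrite /= mul1r normrX ger0_norm.
  move=> k; rewrite mulrAC; apply: le_trans (zz k i) (ler_norm _).
pose zeta i := limn (z ^~ i).
exists zeta => i.
have c1 : z k.+1 i @[k --> \oo] --> zeta i.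
  by rewrite (cvg_shiftS (z ^~ i)); exact: cz.
have c2 : z k.+1 i @[k --> \oo] -->
    a0 + rsum (fun j => (x j < x i)%R%:R * F j (zeta j)).
  apply: cvgD; first exact: cvg_cst.
  apply: (tannery aD).
    by apply: nearW => k j; apply: (le_trans (mask_le _ _)); exact: FD.
  move=> j; apply: cvgMr.
  apply/cvgrPdist_le => e e0.
  have De : 0 < e / (1 + D j) by rewrite divr_gt0// ltr_pwDl.
  near=> k; apply: (le_trans (FL _ _ _)).
  apply: (@le_trans _ _ (D j * (e / (1 + D j)))).
    rewrite ler_wpM2l//; near: k.
    by have /cvgrPdist_le/(_ _ De) := cz j.
  by rewrite mulrCA ger_pMr// ler_pdivrMr ?mul1r ?lerDr// ltr_pwDl.
by rewrite -(cvg_lim _ c1)// (cvg_lim _ c2).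
Unshelve. all: by end_near. Qed.

Lemma jump_path_start (G : nat -> R -> R) a0 z t0 : (forall i, t0 < x i) ->
  jump_path G a0 z t0 = a0.
Proof.
move=> xt; rewrite /jump_path -[RHS]addr0 -(@rsum0 R); congr (_ + _).
by apply: eq_rsum => i; rewrite leNgt xt mul0r.
Qed.

Lemma jump_path_right (G : nat -> R -> R) a0 z u :
  (forall i z, `|G i z| <= D i) ->
  jump_path G a0 z t @[t --> u^'+] --> jump_path G a0 z u.
Proof.
move=> GD; apply: cvgD; first exact: cvg_cst.
apply: (tannery aD).
  by apply: nearW => t i; apply: (le_trans (mask_le _ _)); exact: GD.
move=> i; apply: cvg_near_cst; have [xu|ux] := leP (x i) u; near=> t.
  have ut : u < t by near: t; exact: nbhs_right_gt.
  by rewrite (le_trans xu (ltW ut)).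
by rewrite leNgt (_ : t < x i)//; near: t; exact: nbhs_right_lt.
Unshelve. all: by end_near. Qed.

Lemma jump_path_left (G : nat -> R -> R) a0 z u :
  (forall i z, `|G i z| <= D i) ->
  jump_path G a0 z t @[t --> u^'-] -->
    a0 + rsum (fun j => (x j < u)%R%:R * G j (z j)).
Proof.
move=> GD; apply: cvgD; first exact: cvg_cst.
apply: (tannery aD).
  by apply: nearW => t i; apply: (le_trans (mask_le _ _)); exact: GD.
move=> i; apply: cvg_near_cst; have [ux|xu] := leP u (x i); near=> t.
  have ut : t < u by near: t; exact: nbhs_left_lt.
  by rewrite leNgt (lt_le_trans ut ux).
by rewrite (ltW (_ : x i < t))//; near: t; exact: nbhs_left_gt.
Unshelve. all: by end_near. Qed.

(** The differences of the left limits satisfy the Gronwall inequality with source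
    [rsum e], and they control the differences of the paths. *)
Lemma jump_stability (G : nat -> R -> R) a0 z y (e : nat -> R) :
  (forall i z, `|G i z| <= D i) -> asum e ->
  (forall i, `|G i (y i) - F i (y i)| <= e i) ->
  jump_solution F a0 z -> jump_solution G a0 y ->
  forall t, `|jump_path G a0 y t - jump_path F a0 z t| <=
    (1 + rsum D * (expR (2 * rsum D) * 2)) * rsum e.
Proof.
move=> GD ae GF zF yG.
have e0 i : 0 <= e i by exact: le_trans (GF i).
have key (b : nat -> bool) : `|rsum (fun j => (b j)%:R * G j (y j)) -
      rsum (fun j => (b j)%:R * F j (z j))| <=
    rsum e + rsum (fun j => (b j)%:R * (D j * `|y j - z j|)) /\
    asum (fun j => D j * `|y j - z j|).
  have L0 : 0 <= rsum D by exact: rsum_ge0.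
  have aDy : asum (fun j => D j * `|y j - z j|).
    apply: asum_le (asumZ (rsum D + rsum D) aD) _ => j.
    rewrite mulrC !normrM ler_wpM2r// normr_id (ger0_norm (addr_ge0 L0 L0)).
    rewrite yG zF opprD addrACA subrr add0r.
    apply: (le_trans (ler_normB _ _)).
    by apply: lerD; apply: (le_trans (ler_norm_rsum_mask _ aD _)) => //;
      exact: ler_rsum_mask.
  split => //; rewrite -rsumB; [|by apply: asum_mask; exact: asum_jump..].
  rewrite -rsumD//; last exact: asum_mask.
  apply: ler_norm_rsum; first by apply: asumD => //; exact: asum_mask.
  move=> j; rewrite -mulrBr normrM normr_nat.
  case: (b j); rewrite ?mul1r ?mul0r ?addr0//.
  rewrite (_ : G j (y j) - F j (z j) =
    (G j (y j) - F j (y j)) + (F j (y j) - F j (z j))); last by ring.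
  by apply: (le_trans (ler_normD _ _)); rewrite lerD.
have re0 : 0 <= rsum e by exact: rsum_ge0.
have yz i : `|y i - z i| <= expR (2 * rsum D) * (2 * rsum e).
  have := @jump_gronwall (fun i => `|y i - z i|) (rsum D + rsum D) (rsum e) re0.
  apply.
    move=> j; rewrite normr_ge0 /= yG zF opprD addrACA subrr add0r.
    apply: (le_trans (ler_normB _ _)).
    by apply: lerD; apply: (le_trans (ler_norm_rsum_mask _ aD _)) => //;
      exact: ler_rsum_mask.
  move=> j; rewrite {1}yG {1}zF opprD addrACA subrr add0r.
  by case: (key (fun k => x k < x j)).
move=> t; rewrite /jump_path opprD addrACA subrr add0r.
have [h aDy] := key (fun k => x k <= t); apply: (le_trans h).
rewrite mulrDl mul1r lerD2l.
apply: (@le_trans _ _ (rsum (fun j => expR (2 * rsum D) * (2 * rsum e) * D j))).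
  apply: ler_rsum; [exact: asum_mask|exact: asumZ|move=> j].
  apply: (@le_trans _ _ (D j * `|y j - z j|)).
    by apply: le_trans (ler_norm _) _; apply: le_trans (mask_le _ _) _;
      rewrite ger0_norm// mulr_ge0.
  by rewrite mulrC ler_wpM2r.
by rewrite rsumZ// mulrC !mulrA.
Qed.

End JumpSystem.
(** * The Euler scheme driven by hitting events *)

Section FirstIndex.
Context {R : realType}.
Implicit Type P : pred nat.

Definition is_first P i := P i && [forall k : 'I_i, ~~ P k].

Lemma is_firstE P (c : R) : exists i0, forall i,
  (is_first P i)%:R * c = (i == i0)%:R * (`[< exists i, P i >]%:R * c).
Proof.
have [exP|nP] := pselect (exists i, P i); last first.
  exists 0%N => i; rewrite (asboolF nP) mul0r mulr0 /is_first.
  by case: (boolP (P i)) => [Pi|_]; rewrite ?mul0r//; exfalso; apply: nP; exists i.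
exists (ex_minn exP) => i; rewrite asboolT// mul1r; congr (_%:R * _); congr nat_of_bool.
case: ex_minnP => i0 Pi0 i0min; apply/idP/eqP => [/andP[Pi /forallP Hi]|->].
  apply/eqP; rewrite eqn_leq i0min// andbT leqNgt; apply/negP => i0i.
  by have := Hi (Ordinal i0i); rewrite /= Pi0.
rewrite /is_first Pi0; apply/forallP => k; apply/negP => /i0min.
by rewrite leqNgt ltn_ord.
Qed.

(** Counting each cell at the first of its points turns a sum over hit cells
    into a sum over points. *)
Lemma rsum_first P (c : R) :
  asum (fun i => (is_first P i)%:R * c) /\
  rsum (fun i => (is_first P i)%:R * c) = `[< exists i, P i >]%:R * c.
Proof.
have [i0 E] := is_firstE P c.
rewrite (funext E); split; [exact: asum_single|exact: rsum_single].
Qed.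

End FirstIndex.

Section Cells.
Context {R : realType}.
Implicit Types (m j : nat) (s t : R) (c : int) (y : R).

Definition cell m y : int := Num.ceil (y * m.+1%:R).

(** The endpoint of the cell that is farthest from 0: amplitudes are controlled
    by a function that decreases with the absolute value of the mark, hence the
    representative must not be closer to 0 than the points of its cell. *)
Definition cell_mark m c : R := (if 0 < c then c else c - 1)%:~R / m.+1%:R.

(** The cells inspected at stage [m] are those with index of absolute value at
    most [(m + 1) ^ 2], so that they have width [1 / (m + 1)] and eventually
    cover every mark. *)
Definition cell_index m (k : nat) : int := k%:Z - (m.+1 * m.+1)%N%:Z.

Definition grid_time m s t j : R := s + j%:R * ((t - s) / m.+1%:R).

Definition jump_box m s t j c : set (R * R) :=
  [set p | (grid_time m s t j < p.1 <= grid_time m s t j.+1) /\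
    p.2 != 0 /\ (c - 1)%:~R / m.+1%:R < p.2 <= c%:~R / m.+1%:R].

(** The scheme only asks which boxes contain a point, not how many points they
    contain. Thus it is measurable for the avoidance events of the point
    process, whose independence is immediate. *)
Fixpoint euler_iter (F : R -> R -> R) m s t (h : set (R * R) -> bool) z j : R :=
  if j isn't j'.+1 then z else
  let u := euler_iter F m s t h z j' in
  u + \sum_(k < (m.+1 * m.+1).*2.+1)
    (h (jump_box m s t j' (cell_index m k)))%:R *
    F (cell_mark m (cell_index m k)) u.

Definition euler F m s t h z := euler_iter F m s t h z m.+1.

Let n0 m : 0 < m.+1%:R :> R. Proof. by rewrite ltr0n. Qed.

Lemma jump_boxE m s t j c p : jump_box m s t j c p <->
  [&& p.2 != 0, grid_time m s t j < p.1 <= grid_time m s t j.+1 &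
     cell m p.2 == c].
Proof.
rewrite /jump_box /cell /= ceil_eq ltr_pdivrMr// ler_pdivlMr//.
split; first by move=> [-> [-> ->]].
by move=> /and3P[-> -> ->].
Qed.

Lemma grid_timeS m s t j :
  grid_time m s t j.+1 = grid_time m s t j + (t - s) / m.+1%:R.
Proof. by rewrite /grid_time -natr1 mulrDl mul1r addrA. Qed.

Lemma grid_time0 m s t : grid_time m s t 0 = s.
Proof. by rewrite /grid_time mul0r addr0. Qed.

Lemma grid_time_last m s t : grid_time m s t m.+1 = t.
Proof. by rewrite /grid_time mulrC divfK ?gt_eqF// addrC subrK. Qed.

Lemma ler_grid_time m s t j : s <= t -> (j <= m)%N ->
  s <= grid_time m s t j /\ grid_time m s t j.+1 <= t.
Proof.
move=> st jm; split.
  by rewrite lerDl mulr_ge0// divr_ge0// subr_ge0.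
rewrite -[leRHS](grid_time_last m s t) lerD2l ler_wpM2r ?ler_nat//.
by rewrite divr_ge0// subr_ge0.
Qed.

Lemma cell_mark_ge m y : `|y| <= `|cell_mark m (cell m y)|.
Proof.
rewrite /cell_mark /cell.
have /andP[h1 h2] := ceil_itv (y * m.+1%:R).
rewrite ceil_gt0 pmulr_lgt0//; case: ltP => y0.
  rewrite gtr0_norm// ger0_norm ?ler_pdivlMr//.
  by rewrite mul0r (le_trans _ h2)// mulr_ge0// ltW.
have yv : (Num.ceil (y * m.+1%:R) - 1)%:~R / m.+1%:R <= y.
  by rewrite ler_pdivrMr// ltW.
by rewrite (ler0_norm y0) ler0_norm ?lerN2// (le_trans yv).
Qed.

Lemma cell_mark_dist m y : `|cell_mark m (cell m y) - y| <= m.+1%:R^-1.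
Proof.
rewrite /cell_mark /cell; have /andP[h1 h2] := ceil_itv (y * m.+1%:R).
move: h1; rewrite rmorphB /= => h1.
rewrite -(ler_pM2r (n0 m)) mulVf ?gt_eqF//.
rewrite -[X in _ * X](ger0_norm (ltW (n0 m))) -normrM mulrBl divfK ?gt_eqF//.
rewrite ler_norml; case: ifP => _; rewrite ?rmorphB /=; lra.
Qed.

Lemma cvg_cell_mark y : cell_mark m (cell m y) @[m --> \oo] --> y.
Proof.
apply/cvgrPdist_le => e e0; near=> m; rewrite distrC.
apply: (le_trans (cell_mark_dist m y)).
near: m; have /cvgrPdist_le/(_ _ e0) := @cvg_harmonic R.
by apply: filterS => m; rewrite sub0r normrN ger0_norm//= invr_ge0.
Unshelve. all: by end_near. Qed.

Lemma near_cell_small y : \forall m \near \oo,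
  (`|cell m y| <= (m.+1 * m.+1)%N%:Z)%R.
Proof.
near=> m.
have ym : `|y| + 1 <= m.+1%:R.
  near: m; have /cvgryPge/(_ (`|y| + 1)) := @cvgr_idn R.
  by apply: filterS => m /le_trans; apply; rewrite ler_nat.
have n1 : 1 <= m.+1%:R :> R by rewrite ler1n.
have /andP[h1 h2] := ceil_itv (y * m.+1%:R).
rewrite /cell -(ler_int R) intr_norm.
have hb : `|y| * m.+1%:R <= (m.+1%:R - 1) * m.+1%:R by rewrite ler_wpM2r//; lra.
have hy : `|y * m.+1%:R| <= (m.+1%:R - 1) * m.+1%:R by rewrite normrM [`|m.+1%:R|]ger0_norm.
move: hy; rewrite ler_norml => /andP[hy1 hy2].
move: h1; rewrite rmorphB /= => h1.
rewrite -pmulrn natrM ler_norml; apply/andP; split; nra.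
Unshelve. all: by end_near. Qed.

Lemma cell_index_sum m c (phi : int -> R) :
  \sum_(k < (m.+1 * m.+1).*2.+1) (c == cell_index m k)%:R * phi (cell_index m k)
  = (`|c| <= (m.+1 * m.+1)%N%:Z)%R%:R * phi c.
Proof.
rewrite /cell_index; move: (m.+1 * m.+1)%N => N.
have [hc|hc] := boolP (`|c| <= N%:Z)%R; last first.
  rewrite mul0r big1// => -[k kN] _ /=; case: eqP => [e|]; last by rewrite mul0r.
  by exfalso; move/negP: hc; apply; rewrite e; lia.
have kE : (`|(c + N%:Z)%R|%N < N.*2.+1)%N by lia.
rewrite (bigD1 (Ordinal kE))//= big1 ?addr0.
  have -> : `|(c + N%:Z)%R|%N%:Z - N%:Z = c by lia.
  by rewrite eqxx.
move=> -[k kN] /eqP kk /=; case: eqP => [e|]; last by rewrite mul0r.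
by exfalso; apply: kk; apply: val_inj; rewrite /= e; lia.
Qed.

End Cells.

Section EulerConvergence.
Context {R : realType}.
Variables (F : R -> R -> R) (x y D : nat -> R).
Hypotheses (D0 : forall i, 0 <= D i) (aD : asum D) (F0 : forall z, F 0 z = 0).
(* The bounds are required at every mark [v] farther from 0 than [y i], because
   [v] will be the representative of the cell of [y i]. *)
Hypotheses (FD : forall i v z, y i != 0 -> `|y i| <= `|v| -> `|F v z| <= D i)
  (FL : forall i v z z', y i != 0 -> `|y i| <= `|v| ->
     `|F v z - F v z'| <= D i * `|z - z'|)
  (Fc : forall i z, y i != 0 -> F v z @[v --> y i] --> F (y i) z)
  (inj : forall i k, y i != 0 -> y k != 0 -> x i = x k -> y i = y k -> i = k).

Definition hits (A : set (R * R)) : bool :=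
  `[< exists i, y i != 0 /\ A (x i, y i) >].

Let G i := F (y i).

Let GD i z : `|G i z| <= D i.
Proof.
rewrite /G; have [->|y0] := eqVneq (y i) 0; first by rewrite F0 normr0.
exact: FD.
Qed.

Variables (a0 : R) (zeta : nat -> R) (s t : R).
Hypotheses (zetaP : jump_solution x G a0 zeta) (st : s <= t).

Let Z := jump_path x G a0 zeta.

Let aG : asum (fun i => G i (zeta i)).
Proof. exact: (@asum_jump _ _ aD G zeta GD). Qed.

Let gap m := (t - s) / m.+1%:R.
Let tau m j := grid_time m s t j.
Let slot m j i := tau m j < x i <= tau m j.+1.

Let gap0 m : 0 <= gap m.
Proof. by rewrite divr_ge0// subr_ge0. Qed.

(** A sufficient condition for the point [i] to be the one that its box is
    counted for, whatever the slot that contains it. *)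
Let isolated m i := (`|cell m (y i)| <= (m.+1 * m.+1)%N%:Z)%R &&
  [forall k : 'I_i, (y k == 0) || (gap m <= `|x i - x k|) ||
     (cell_mark m (cell m (y k)) != cell_mark m (cell m (y i)) :> R)].

Let mark_error m i := (y i != 0)%:R *
  (if isolated m i then `|F (cell_mark m (cell m (y i))) (zeta i) - G i (zeta i)|
   else D i *+ 2).

(** An upper bound for the variation of the path over the part of its slot that
    precedes [x i]. *)
Let time_error m i := rsum (fun l => (x i - gap m <= x l < x i)%R%:R * D l).

Let local_error m i := D i * time_error m i + mark_error m i.

Let point m j c i := [&& y i != 0, slot m j i & cell m (y i) == c].

Let increment m j u i := \sum_(k < (m.+1 * m.+1).*2.+1)
  (is_first (point m j (cell_index m k)) i)%:R * F (cell_mark m (cell_index m k)) u.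

Let euler_iterS m z j : let u := euler_iter F m s t hits z j in
  asum (increment m j u) /\
  euler_iter F m s t hits z j.+1 = u + rsum (increment m j u).
Proof.
move=> u; split.
  by apply: asum_sum => k; case: (rsum_first (point m j (cell_index m k))
    (F (cell_mark m (cell_index m k)) u)).
rewrite /= -/u rsum_sum; last first.
  by move=> k; case: (rsum_first (point m j (cell_index m k))
    (F (cell_mark m (cell_index m k)) u)).
congr (_ + _); apply: eq_bigr => k _.
case: (rsum_first (point m j (cell_index m k))
  (F (cell_mark m (cell_index m k)) u)) => _ ->.
congr (_ %:R * _); congr nat_of_bool; apply/asboolP/asboolP => -[i].
  by move=> [_] /jump_boxE /= h; exists i.
by move=> h; exists i; split; [case/andP: h|apply/jump_boxE].
Qed.

Let incrementE m j u i : increment m j u i =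
  (is_first (point m j (cell m (y i))) i &&
     (`|cell m (y i)| <= (m.+1 * m.+1)%N%:Z)%R)%:R *
  F (cell_mark m (cell m (y i))) u.
Proof.
rewrite -mulnb natrM -mulrA.
transitivity ((`|cell m (y i)| <= (m.+1 * m.+1)%N%:Z)%R%:R *
  ((is_first (point m j (cell m (y i))) i)%:R *
   F (cell_mark m (cell m (y i))) u)); last by rewrite mulrCA.
rewrite -(cell_index_sum _ _ (fun c => (is_first (point m j c) i)%:R *
  F (cell_mark m c) u)).
apply: eq_bigr => k _; case: eqP => [_|ne]; first by rewrite mul1r.
rewrite mul0r (_ : is_first _ _ = false) ?mul0r//.
by apply/negP => /andP[/and3P[_ _ /eqP]].
Qed.

Let increment_error m j u i :
  `|increment m j u i - (slot m j i)%:R * G i (zeta i)| <=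
  (slot m j i)%:R * (D i * `|u - zeta i| + mark_error m i).
Proof.
rewrite incrementE; have [sl|nsl] := boolP (slot m j i); last first.
  rewrite !mul0r subr0 (_ : is_first _ _ = false) ?mul0r ?normr0//.
  by rewrite /is_first /point (negbTE nsl) andbF.
rewrite !mul1r; have [y0|y0] := eqVneq (y i) 0.
  rewrite /mark_error y0 eqxx mul0r addr0 /G y0 F0 subr0.
  rewrite (_ : is_first _ _ = false) ?mul0r ?normr0 ?mulr_ge0//.
  by rewrite /is_first /point y0 eqxx.
have ym := cell_mark_ge m (y i); set v := cell_mark _ _ in ym *.
rewrite /mark_error y0 mul1r -/v; case: ifPn => [/andP[small iso]|_].
  rewrite small andbT.
  have -> : is_first (point m j (cell m (y i))) i.
    rewrite /is_first /point y0 sl eqxx /=; apply/forallP => k.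
    apply/negP => /and3P[yk /andP[k1 k2] /eqP ck].
    move/forallP: iso => /(_ k); rewrite ck eqxx orbF (negbTE yk) /=.
    apply/negP; rewrite -ltNge.
    move: sl k1 k2; rewrite /slot /tau grid_timeS -/(gap m) => /andP[].
    by rewrite ltr_norml; lra.
  rewrite mul1r (_ : F v u - _ = (F v u - F v (zeta i)) +
    (F v (zeta i) - G i (zeta i))); last by ring.
  by apply: (le_trans (ler_normD _ _)); rewrite lerD2r FL.
apply: (@le_trans _ _ (D i *+ 2)); last by rewrite lerDr mulr_ge0.
apply: (le_trans (ler_normB _ _)); rewrite mulr2n lerD//.
by apply: (le_trans (mask_le _ _)); exact: FD.
Qed.

Let mark_error_le m i : 0 <= mark_error m i <= D i *+ 2.
Proof.
rewrite /mark_error; have [y0|y0] := eqVneq (y i) 0.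
  by rewrite mul0r lexx mulrn_wge0.
rewrite mul1r; case: ifP => _; last by rewrite lexx mulrn_wge0.
rewrite normr_ge0 /=; apply: (le_trans (ler_normB _ _)).
by rewrite mulr2n lerD// FD// cell_mark_ge.
Qed.

Let time_error_le m i : 0 <= time_error m i <= rsum D.
Proof.
rewrite rsum_ge0 ?ler_rsum_mask//; first exact: asum_mask.
by move=> l; rewrite mulr_ge0.
Qed.

Let local_error_le m i : 0 <= local_error m i <= D i * (rsum D + 2).
Proof.
have /andP[t0 t1] := time_error_le m i; have /andP[m0 m1] := mark_error_le m i.
rewrite /local_error; apply/andP; split; first by rewrite addr_ge0// mulr_ge0.
by rewrite mulrDr lerD// ?ler_wpM2l// mulr_natr.
Qed.

Let asum_local m : asum (local_error m).
Proof.
apply: asum_le (asumZ (rsum D + 2) aD) _ => i.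
have /andP[e0 e1] := local_error_le m i; rewrite ger0_norm// mulrC.
exact: le_trans e1 (ler_norm _).
Qed.

Let slotE m j i (r : R) : (x i <= tau m j.+1)%R%:R * r =
  (x i <= tau m j)%R%:R * r + (slot m j i)%:R * r.
Proof.
have tj : tau m j <= tau m j.+1 by rewrite /tau grid_timeS lerDl gap0.
rewrite /slot; case: (leP (x i) (tau m j)) => [xi|_].
  by rewrite (le_trans xi tj) mul0r addr0.
by rewrite mul0r add0r.
Qed.

Let ZS m j : Z (tau m j.+1) =
  Z (tau m j) + rsum (fun i => (slot m j i)%:R * G i (zeta i)).
Proof.
rewrite /Z /jump_path -addrA -rsumD; [|exact: asum_mask..].
by congr (_ + _); apply: eq_rsum => i; exact: slotE.
Qed.

Let Z_zeta m j i : slot m j i -> `|Z (tau m j) - zeta i| <= time_error m i.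
Proof.
move=> sl; rewrite zetaP /Z /jump_path opprD addrACA subrr add0r -rsumB;
  [|exact: asum_mask..].
apply: ler_norm_rsum; first exact: asum_mask.
move=> l; rewrite -mulrBl normrM ler_pM//.
move: sl; rewrite /slot /tau grid_timeS -/(gap m) => /andP[].
move: (grid_time m s t j) => r r1 r2.
have [xl|xl] := leP (x l) r.
  by rewrite (le_lt_trans xl r1) subrr normr0.
have -> : x i - gap m <= x l by lra.
by rewrite sub0r normrN normr_nat.
Qed.

Let bound m j := expR (rsum (fun i => (x i <= tau m j)%R%:R * D i)) *
  rsum (fun i => (x i <= tau m j)%R%:R * local_error m i).

Let growth (a b k e E : R) : 1 <= a -> 1 <= b -> 1 + k <= b -> 0 <= e ->
  0 <= E -> a * E + (a * E * k + e) <= a * b * (E + e).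
Proof.
move=> a1 b1 kb e0 E0.
have h1 : a * E * (1 + k) <= a * E * b.
  by rewrite ler_wpM2l// mulr_ge0//; exact: le_trans a1.
have h2 : e <= a * b * e.
  by rewrite ler_peMl//; apply: (le_trans a1); rewrite ler_peMr// (le_trans _ a1).
lra.
Qed.

Let euler_bound m j :
  `|euler_iter F m s t hits (Z s) j - Z (tau m j)| <= bound m j.
Proof.
elim: j => [|j IH].
  rewrite /tau grid_time0 subrr normr0 mulr_ge0 ?expR_ge0// rsum_ge0//.
    exact: asum_mask.
  by move=> i; rewrite mulr_ge0//; case/andP: (local_error_le m i).
have [ai ->] := euler_iterS m (Z s) j.
set u := euler_iter F m s t hits (Z s) j in IH ai *.
rewrite ZS opprD addrACA; apply: (le_trans (ler_normD _ _)).
have asl (f : nat -> R) : asum f -> asum (fun i => (slot m j i)%:R * f i).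
  exact: asum_mask.
pose kappa := rsum (fun i => (slot m j i)%:R * D i).
pose eps := rsum (fun i => (slot m j i)%:R * local_error m i).
have kappa0 : 0 <= kappa.
  by apply: rsum_ge0 => [|i]; [exact: asl|rewrite mulr_ge0].
have eps0 : 0 <= eps.
  apply: rsum_ge0 => [|i]; first exact: asl.
  by rewrite mulr_ge0//; case/andP: (local_error_le m i).
have step : `|rsum (increment m j u) -
    rsum (fun i => (slot m j i)%:R * G i (zeta i))| <= bound m j * kappa + eps.
  rewrite -rsumB//; last exact: asum_mask.
  have -> : bound m j * kappa + eps = rsum (fun i =>
      bound m j * ((slot m j i)%:R * D i) + (slot m j i)%:R * local_error m i).
    rewrite rsumD; [|by apply: asumZ; exact: asl|exact: asl].
    by rewrite rsumZ//; exact: asl.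
  apply: ler_norm_rsum.
    by apply: asumD; [apply: asumZ; exact: asl|exact: asl].
  move=> i; apply: (le_trans (increment_error _ _ _ _)).
  rewrite mulrCA -mulrDr; case: (boolP (slot m j i)) => sl; last by rewrite !mul0r.
  rewrite !mul1r /local_error addrA lerD2r [bound m j * _]mulrC -mulrDr ler_wpM2l//.
  rewrite (_ : u - zeta i = (u - Z (tau m j)) + (Z (tau m j) - zeta i)); last by ring.
  by apply: (le_trans (ler_normD _ _)); rewrite lerD// Z_zeta.
apply: (le_trans (lerD IH step)).
have am (f : nat -> R) : asum f -> asum (fun i => (x i <= tau m j)%R%:R * f i).
  exact: asum_mask.
have hM : rsum (fun i => (x i <= tau m j.+1)%R%:R * D i) =
    rsum (fun i => (x i <= tau m j)%R%:R * D i) + kappa.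
  rewrite -rsumD; [|exact: am|exact: asl].
  by apply: eq_rsum => i; exact: slotE.
have hE : rsum (fun i => (x i <= tau m j.+1)%R%:R * local_error m i) =
    rsum (fun i => (x i <= tau m j)%R%:R * local_error m i) + eps.
  rewrite -rsumD; [|exact: am|exact: asl].
  by apply: eq_rsum => i; exact: slotE.
rewrite /bound hM hE expRD.
set M := rsum _; set E := rsum (fun i => _ * local_error m i).
have M0 : 0 <= M by apply: rsum_ge0 => [|i]; [exact: am|rewrite mulr_ge0].
have E0 : 0 <= E.
  apply: rsum_ge0 => [|i]; first exact: am.
  by rewrite mulr_ge0//; case/andP: (local_error_le m i).
have M1 : 1 <= expR M by rewrite -[leLHS]expR0 ler_expR.
have k1 : 1 <= expR kappa by rewrite -[leLHS]expR0 ler_expR.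
by apply: growth => //; exact: expR_ge1Dx.
Qed.

Let euler_error m : `|euler F m s t hits (Z s) - Z t| <=
  expR (rsum D) * rsum (local_error m).
Proof.
have := euler_bound m m.+1; rewrite /tau grid_time_last => /le_trans; apply.
rewrite /bound ler_pM ?expR_ge0//.
- apply: rsum_ge0 => [|i]; first exact: asum_mask.
  by rewrite mulr_ge0//; case/andP: (local_error_le m i).
- by rewrite ler_expR ler_rsum_mask.
- by apply: ler_rsum_mask => // i; case/andP: (local_error_le m i).
Qed.

Let cvg_gap : gap m @[m --> \oo] --> 0.
Proof.
rewrite -[0](mulr0 (t - s)); apply: cvgMr.
exact: cvg_harmonic.
Qed.

Let near_isolated i : y i != 0 -> \forall m \near \oo, isolated m i.
Proof.
move=> yi; near=> m; apply/andP; split; first by near: m; exact: near_cell_small.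
apply/forallP; near: m; apply: filter_forall => k.
have [yk|yk] := eqVneq (y k) 0; first exact: nearW.
have [xk|xk] := eqVneq (x i) (x k).
  have yik : y i != y k.
    apply/eqP => /(inj yi yk xk) ik; have := ltn_ord k.
    by rewrite -[X in (_ < X)%N]/(id i) {2}ik ltnn.
  have c : cell_mark m (cell m (y k)) - cell_mark m (cell m (y i)) @[m --> \oo]
      --> y k - y i by apply: cvgB; exact: cvg_cell_mark.
  have c0 : y k - y i != 0 by rewrite subr_eq0 eq_sym.
  have h0 := cvgr_neq0 _ c c0; near=> m.
  rewrite -(subr_eq0 (cell_mark m _)) orbC (_ : _ != 0)//.
  by near: m; exact: h0.
have d0 : 0 < `|x i - x k| by rewrite normr_gt0 subr_eq0.
have /cvgrPdist_le/(_ _ d0) := cvg_gap; apply: filterS => m.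
by rewrite sub0r normrN ger0_norm// => ->.
Unshelve. all: by end_near. Qed.

Let cvg_mark_error i : mark_error m i @[m --> \oo] --> 0.
Proof.
have [y0|y0] := eqVneq (y i) 0.
  rewrite /mark_error y0 eqxx; under eq_fun do rewrite mul0r; exact: cvg_cst.
have c : `|F (cell_mark m (cell m (y i))) (zeta i) - G i (zeta i)| @[m --> \oo]
    --> 0.
  rewrite -(normr0 R) -(subrr (G i (zeta i))).
  apply: cvg_norm; apply: cvgB; last exact: cvg_cst.
  apply: (cvg_comp (fun m => cell_mark m (cell m (y i))) (F ^~ (zeta i))).
    exact: cvg_cell_mark.
  exact: Fc.
apply: cvg_trans c; apply: near_eq_cvg.
have := near_isolated y0; apply: filterS => m h.
by rewrite /mark_error y0 mul1r h.
Qed.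

Let cvg_time_error i : time_error m i @[m --> \oo] --> 0.
Proof.
rewrite -[0](@rsum0 R); apply: (tannery aD).
  apply: nearW => m l; apply: (le_trans (mask_le _ _)).
  by rewrite ger0_norm.
move=> l; apply: cvg_near_cst.
have [xl|xl] := leP (x i) (x l).
  by apply: nearW => m; rewrite andbF mul0r.
have d0 : 0 < (x i - x l) / 2 by rewrite divr_gt0// subr_gt0.
have /cvgrPdist_le/(_ _ d0) := cvg_gap; apply: filterS => m.
rewrite sub0r normrN ger0_norm// => h.
rewrite (_ : _ <= x l = false) ?mul0r//; apply/negP; lra.
Qed.

(** Between two grid times the scheme freezes the state and moves each mark to
    the representative of its cell, at a cost which tends to 0 for every single
    point and is dominated; a discrete Gronwall inequality propagates the total
    cost. *)
Lemma cvg_euler :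
  euler F m s t hits (jump_path x G a0 zeta s) @[m --> \oo] -->
  jump_path x G a0 zeta t.
Proof.
have c : expR (rsum D) * rsum (local_error m) @[m --> \oo] --> 0.
  rewrite -[0](mulr0 (expR (rsum D))); apply: cvgMr.
  rewrite -[0](@rsum0 R); apply: (@tannery _ _ _ _ _ _ (fun i => (rsum D + 2) * D i)).
  - exact: asumZ.
  - apply: nearW => m i; have /andP[e0 e1] := local_error_le m i.
    by rewrite ger0_norm// mulrC.
  - move=> i; rewrite -[0]addr0; apply: cvgD; last exact: cvg_mark_error.
    by rewrite -[0](mulr0 (D i)); apply: cvgMr; exact: cvg_time_error.
apply/cvgrPdist_le => e e0; have /cvgrPdist_le/(_ _ e0) := c.
apply: filterS => m; rewrite sub0r normrN ger0_norm => [h|].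
  by rewrite distrC; apply: le_trans h; exact: euler_error.
rewrite mulr_ge0 ?expR_ge0// rsum_ge0// => i.
by case/andP: (local_error_le m i).
Qed.

End EulerConvergence.
(** * Bounds on the amplitude of a jump *)

Section Amplitude.
Context {R : realType}.

Definition amplitude (alpha : R -> R) (y z : R) : R :=
  signed_pow y (- (alpha z)^-1).

Lemma expR_lipschitz (p q : R) :
  `|expR p - expR q| <= `|p - q| * (expR p + expR q).
Proof.
wlog pq : p q / q <= p.
  move=> H; have [|/ltW] := leP q p; first exact: H.
  by move=> /H; rewrite distrC [X in X * _]distrC [X in _ * X]addrC.
rewrite ger0_norm ?subr_ge0 ?ler_expR// ger0_norm ?subr_ge0//.
have := expR_ge1Dx (q - p); rewrite expRD.
have p0 := expR_gt0 p; have q0 := expR_gt0 q => h.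
have h1 : expR p * (1 + (q - p)) <= expR q.
  apply: le_trans (ler_wpM2l (ltW p0) h) _.
  by rewrite mulrCA -expRD subrr expR0 mulr1.
have h2 : 0 <= (p - q) * expR q by rewrite mulr_ge0// ?subr_ge0// ltW.
lra.
Qed.

Section TwoPowers.
Variables (beta gamma eta : R).
Hypotheses (eta0 : 0 < eta) (beta0 : 0 < beta) (betagamma : beta <= gamma).

Let g l := expR (- (beta * l)) + expR (- (gamma * l)).

Let g_pow sigma l : beta <= sigma <= gamma -> expR (- (sigma * l)) <= g l.
Proof.
move=> /andP[bs sg]; have [l0|l0] := leP 0 l.
  apply: (@le_trans _ _ (expR (- (beta * l)))); last by rewrite lerDl expR_ge0.
  by rewrite ler_expR lerN2 ler_wpM2r.
apply: (@le_trans _ _ (expR (- (gamma * l)))); last by rewrite lerDr expR_ge0.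
by rewrite ler_expR lerN2 ler_wnM2r// ltW.
Qed.

(** The logarithm costs a factor [exp (eta l)] at large marks and [exp (- l)] at
    small ones. *)
Let g_log sigma l : beta + eta <= sigma -> sigma + 1 <= gamma ->
  `|l| * expR (- (sigma * l)) <= (eta^-1 + 1) * g l.
Proof.
move=> bs sg; have e0 : 0 <= eta^-1 by rewrite invr_ge0 ltW.
rewrite mulrDl mul1r; have [l0|l0] := leP 0 l.
  apply: (@le_trans _ _ (eta^-1 * expR (eta * l - sigma * l))).
    rewrite expRD mulrA ler_wpM2r ?expR_ge0// ger0_norm// ler_pdivlMl//.
    by apply: le_trans (expR_ge1Dx _); rewrite lerDr.
  apply: (@le_trans _ _ (eta^-1 * g l)); last first.
    by rewrite lerDl addr_ge0 ?expR_ge0.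
  rewrite ler_wpM2l// -mulrBl -[X in _ <= X]/(g l).
  have h := eta0; have := @g_pow (sigma - eta) l; rewrite -mulNr opprB; apply.
  by apply/andP; split; lra.
rewrite ltr0_norm//.
apply: (@le_trans _ _ (expR (- l - sigma * l))).
  rewrite expRD ler_wpM2r ?expR_ge0//.
  by apply: le_trans (expR_ge1Dx _); rewrite lerDr.
apply: (@le_trans _ _ (g l)).
  have h := eta0; have := @g_pow (sigma + 1) l; rewrite mulrDl mul1r opprD
    [- (sigma * l) - l]addrC; apply.
  by apply/andP; split; lra.
by rewrite lerDr mulr_ge0// addr_ge0 ?expR_ge0.
Qed.

Definition two_powers (y : R) : R := `|y| `^ (- beta) + `|y| `^ (- gamma).

Lemma two_powersE y : y != 0 ->
  two_powers y = expR (- (beta * ln `|y|)) + expR (- (gamma * ln `|y|)).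
Proof. by move=> y0; rewrite /two_powers /powR normr_eq0 (negbTE y0) !mulNr. Qed.

Lemma two_powers0 : two_powers 0 = 0.
Proof.
by rewrite /two_powers normr0 !powR0 ?addr0// oppr_eq0 gt_eqF// (lt_le_trans beta0).
Qed.

Lemma two_powers_ge0 y : 0 <= two_powers y.
Proof. by rewrite addr_ge0// powR_ge0. Qed.

Lemma two_powers_anti y v : y != 0 -> `|y| <= `|v| -> two_powers v <= two_powers y.
Proof.
move=> y0 yv; have ny0 : 0 < `|y| by rewrite normr_gt0.
have v0 : v != 0 by rewrite -normr_gt0 (lt_le_trans ny0).
rewrite !two_powersE//; have ll : ln `|y| <= ln `|v|.
  by rewrite ler_ln// posrE// (lt_le_trans ny0).
have g0 : 0 < gamma by exact: lt_le_trans beta0 _.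
by rewrite lerD// ler_expR lerN2 ler_wpM2l// ltW.
Qed.

Lemma signed_powE (y s : R) : y != 0 -> signed_pow y s = Num.sg y * expR (s * ln `|y|).
Proof. by move=> y0; rewrite /signed_pow /powR normr_eq0 (negbTE y0). Qed.

Lemma signed_pow0 (s : R) : signed_pow 0 s = 0 :> R.
Proof. by rewrite /signed_pow sgr0 mul0r. Qed.

Lemma norm_signed_pow_le y sigma : beta <= sigma <= gamma ->
  `|signed_pow y (- sigma)| <= two_powers y.
Proof.
move=> h; have [->|y0] := eqVneq y 0.
  by rewrite signed_pow0 normr0 two_powers_ge0.
rewrite signed_powE// normrM normr_sg y0 mul1r ger0_norm ?expR_ge0//.
by rewrite two_powersE// mulNr; exact: g_pow.
Qed.

Lemma signed_pow_lipschitz y sigma sigma' :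
  beta + eta <= sigma -> sigma + 1 <= gamma ->
  beta + eta <= sigma' -> sigma' + 1 <= gamma ->
  `|signed_pow y (- sigma) - signed_pow y (- sigma')| <=
    2 * (eta^-1 + 1) * two_powers y * `|sigma - sigma'|.
Proof.
move=> h1 h2 h3 h4; have e0 : 0 <= eta^-1 by rewrite invr_ge0 ltW.
have [->|y0] := eqVneq y 0.
  by rewrite !signed_pow0 subr0 normr0 !mulr_ge0// ?addr_ge0// two_powers_ge0.
rewrite !signed_powE// -mulrBr normrM normr_sg y0 mul1r.
apply: (le_trans (expR_lipschitz _ _)); rewrite two_powersE//.
have g1 := g_log (ln `|y|) h1 h2; have g2 := g_log (ln `|y|) h3 h4.
have -> : `|- sigma * ln `|y| - - sigma' * ln `|y| | =
    `|sigma - sigma'| * `|ln `|y| |.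
  by rewrite -normrM -normrN; congr `|_|; ring.
rewrite !mulNr -/(g (ln `|y|)) -mulrA [leRHS]mulrC ler_wpM2l// mulrDr.
move: g1 g2; lra.
Qed.

Lemma continuous_signed_pow (y s : R) : y != 0 ->
  signed_pow v s @[v --> y] --> signed_pow y s.
Proof.
move=> y0; have ny0 : 0 < `|y| by rewrite normr_gt0.
rewrite signed_powE//.
have c : Num.sg y * expR (s * ln `|v|) @[v --> y] --> Num.sg y * expR (s * ln `|y|).
  apply: cvgMr; apply: (cvg_comp (fun v => s * ln `|v|) expR); last first.
    exact: continuous_expR.
  apply: cvgMr; apply: (cvg_comp (fun v => `|v|) (@ln R)); last exact: continuous_ln.
  exact: norm_continuous.
apply: cvg_trans c; apply: near_eq_cvg.
have [yp|yn] := ltP 0 y.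
  near=> v; have v0 : 0 < v by near: v; exact: lt_nbhsr.
  by rewrite signed_powE ?gt_eqF// !gtr0_sg.
have y0' : y < 0 by rewrite lt_neqAle y0.
near=> v; have v0 : v < 0 by near: v; exact: lt_nbhsl.
by rewrite signed_powE ?lt_eqF// !ltr0_sg.
Unshelve. all: by end_near. Qed.

End TwoPowers.

(** If the tail exponent [beta] exceeds 1 then the geometric annuli, whose areas
    are proportional to [2 ^ k], carry a summable total amplitude. *)
Lemma asum_two_powers (beta gamma : R) : 1 < beta -> beta <= gamma ->
  asum (fun k => 2 ^+ k * two_powers beta gamma (2 ^+ k)).
Proof.
move=> b1 bg; pose q : R := expR ((1 - beta) * ln 2).
have l2 : 0 < ln 2 :> R by rewrite ln_gt0// ltr1n.
have q0 : 0 <= q by exact: expR_ge0.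
have q1 : q < 1.
  by rewrite -[ltRHS]expR0 ltr_expR pmulr_llt0// subr_lt0.
apply: (@asum_le _ (fun k => 2 * q ^+ k)).
  apply: asumZ; apply: (@eq_asum _ (geometric 1 q)).
    by move=> k; rewrite /= mul1r.
  rewrite /asum (_ : (fun k => _) = geometric 1 q).
    by apply: is_cvg_geometric_series; rewrite ger0_norm.
  by apply/funext => k; rewrite /= mul1r normrX ger0_norm.
move=> k; have k0 : (2 : R) ^+ k != 0 by rewrite expf_neq0.
have nk : `|2 ^+ k| = 2 ^+ k :> R by rewrite ger0_norm// exprn_ge0.
rewrite !ger0_norm ?mulr_ge0 ?exprn_ge0 ?two_powers_ge0//.
rewrite two_powersE// nk lnXn//.
have -> : 2 ^+ k = expR (ln 2 *+ k) :> R.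
  by rewrite -lnXn// lnK// posrE exprn_gt0.
have -> : q ^+ k = expR ((1 - beta) * (ln 2 *+ k)).
  by rewrite -expRM_natl /q mulrnAr mulr_natl.
have L0 : 0 <= ln 2 *+ k :> R by rewrite mulrn_wge0// ltW.
move: (ln 2 *+ k) L0 => L L0.
rewrite mulrDr -!expRD mulr_natl mulr2n lerD// ler_expR mulrBl mul1r//.
by rewrite lerD2l lerN2 ler_wpM2r.
Qed.

Lemma lipschitz_of_derive (f : R -> R) M :
  (forall x, derivable f x 1) -> (forall x, `|derive1 f x| <= M) ->
  forall x y, `|f x - f y| <= M * `|x - y|.
Proof.
move=> df fM x y; wlog yx : x y / y <= x.
  move=> H; have [|/ltW] := leP y x; first exact: H.
  by move=> /H; rewrite distrC [X in _ * X]distrC.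
have [||c _ ->] := @MVT_segment _ f (derive1 f) y x yx.
- by move=> z _; rewrite derive1E; apply/derivableP; exact: df.
- by apply: derivable_within_continuous => z _; exact: df.
by rewrite normrM ler_wpM2r.
Qed.

(** A dominating function for the amplitudes and for their dependence on the
    state. It is a sum of two powers: one with exponent in ]-1/b, -1[ controls the
    large marks, whence summability, and one controls the small marks. *)
Lemma amplitude_majorant (a b : R) (alpha : R -> R) :
  0 < a -> a < b -> b < 1 -> (forall x, a <= alpha x <= b) ->
  (forall x, derivable alpha x 1) ->
  (exists M, forall x, `|derive1 alpha x| <= M) ->
  exists D : R -> R, [/\ D 0 = 0, forall y, 0 <= D y,
    forall y v, y != 0 -> `|y| <= `|v| -> D v <= D y,
    asum (fun k => 2 ^+ k * D (2 ^+ k)) &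
    (forall y z, `|amplitude alpha y z| <= D y) /\
    (forall y z z', `|amplitude alpha y z - amplitude alpha y z'| <=
      D y * `|z - z'|)].
Proof.
move=> a0 ab b1 alphaab dalpha [M alphaM].
have M0 : 0 <= M by exact: le_trans (alphaM 0).
have b0 : 0 < b by exact: lt_trans ab.
have ib : 1 < b^-1 by rewrite invf_gt1.
have ia : b^-1 <= a^-1 by rewrite lef_pV2 ?posrE// ltW.
pose beta := (1 + b^-1) / 2; pose eta := (b^-1 - 1) / 2; pose gamma := a^-1 + 1.
have eta0 : 0 < eta by rewrite /eta; lra.
have beta1 : 1 < beta by rewrite /beta; lra.
have bg : beta <= gamma by rewrite /beta /gamma; lra.
have be : beta + eta = b^-1 by rewrite /beta /eta; lra.
have beta0 : 0 < beta by lra.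
have apos x : 0 < alpha x by case/andP: (alphaab x) => h _; exact: lt_le_trans h.
have inv_alpha x : b^-1 <= (alpha x)^-1 <= a^-1.
  by case/andP: (alphaab x) => h1 h2; rewrite !lef_pV2 ?posrE// h1 h2.
have inv_lip x y : `|(alpha x)^-1 - (alpha y)^-1| <= M / a ^+ 2 * `|x - y|.
  have -> : (alpha x)^-1 - (alpha y)^-1 =
      - (alpha x - alpha y) / (alpha x * alpha y).
    by field; rewrite !gt_eqF.
  rewrite normrM normrN mulrAC; apply: ler_pM => //.
    exact: lipschitz_of_derive.
  rewrite ger0_norm; last by rewrite invr_ge0 mulr_ge0// ltW.
  rewrite lef_pV2 ?posrE ?exprn_gt0 ?mulr_gt0// expr2.
  by case/andP: (alphaab x) => h1 _; case/andP: (alphaab y) => h2 _;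
    rewrite ler_pM// ltW.
pose C := 1 + 2 * (eta^-1 + 1) * (M / a ^+ 2).
have C1 : 0 <= 2 * (eta^-1 + 1) * (M / a ^+ 2).
  by rewrite !mulr_ge0// ?addr_ge0// ?invr_ge0 ?exprn_ge0// ltW.
exists (fun y => C * two_powers beta gamma y); split.
- by rewrite two_powers0// mulr0.
- by move=> y; rewrite mulr_ge0 ?two_powers_ge0// addr_ge0.
- by move=> y v y0 yv; rewrite ler_wpM2l ?addr_ge0// two_powers_anti.
- apply: (@eq_asum _ (fun k => C * (2 ^+ k * two_powers beta gamma (2 ^+ k)))).
    by move=> k; rewrite mulrCA.
  by apply: asumZ; exact: asum_two_powers.
- split=> [y z|y z z'].
    apply: (@le_trans _ _ (two_powers beta gamma y)).
      apply: norm_signed_pow_le; have /andP[h1 h2] := inv_alpha z.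
      by rewrite /gamma; apply/andP; split; lra.
    by rewrite mulrDl mul1r lerDl mulr_ge0// two_powers_ge0.
  have /andP[h1 h2] := inv_alpha z; have /andP[h3 h4] := inv_alpha z'.
  apply: (le_trans (@signed_pow_lipschitz beta gamma eta eta0 y _ _ _ _ _ _));
    rewrite ?be// ?lerD2r//.
  apply: (@le_trans _ _ (2 * (eta^-1 + 1) * two_powers beta gamma y *
      (M / a ^+ 2 * `|z - z'|))).
    rewrite ler_wpM2l// !mulr_ge0// ?two_powers_ge0// addr_ge0// invr_ge0 ltW//.
  have -> : 2 * (eta^-1 + 1) * two_powers beta gamma y * (M / a ^+ 2 * `|z - z'|)
    = 2 * (eta^-1 + 1) * (M / a ^+ 2) * (two_powers beta gamma y * `|z - z'|).
    by ring.
  by rewrite -[leRHS]mulrA ler_wpM2r ?lerDr// mulr_ge0// two_powers_ge0.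
Qed.

End Amplitude.
(** * Point configurations and the jump equation *)

Section Enumeration.
Context {R : realType}.
Implicit Types (S : set (R * R)) (x y : nat -> R).

(** An index with [y i = 0] carries no point. Points with zero mark do not
    contribute to the jumps, so they need not be listed; this makes room for
    finite configurations, and truncation amounts to replacing marks by 0. *)
Definition enumerates S x y :=
  [/\ forall i, y i != 0 -> S (x i, y i),
      forall q, S q -> q.2 != 0 -> exists i, (x i, y i) = q &
      forall i k, y i != 0 -> y k != 0 -> x i = x k -> y i = y k -> i = k].

Lemma enumeration_exists S (x0 : R) : countable S ->
  exists x y, enumerates S x y /\ forall i, y i = 0 -> x i = x0.
Proof.
move=> /countable_injP[f finj].
pose P i q := [/\ S q, q.2 != 0 & f q = i].
pose p i := xget (x0, 0 : R) (P i).
have pP i : P i (p i) \/ p i = (x0, 0).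
  by rewrite /p; case: xgetP => [q _|]; [left|right].
have pS i : (p i).2 != 0 -> P i (p i).
  by case: (pP i) => [//|->]; rewrite /= eqxx.
exists (fun i => (p i).1), (fun i => (p i).2); split; last first.
  by move=> i; case: (pP i) => [[_ /eqP]|->].
split.
- by move=> i /pS[]; rewrite -surjective_pairing.
- move=> q Sq q0; exists (f q); rewrite -surjective_pairing.
  have [Sp p0 fp] : P (f q) (p (f q)) by rewrite /p; exact: (xgetI _ (x := q)).
  by apply: finj; rewrite ?inE.
- move=> i k /pS[_ _ fi] /pS[_ _ fk] e1 e2; rewrite -fi -fk; congr f.
  by rewrite (surjective_pairing (p i)) e1 e2 -surjective_pairing.
Qed.

Lemma enumerates_trunc S x y r : enumerates S x y ->
  enumerates (S `&` [set p | `|p.2| <= r]) x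
    (fun i => if `|y i| <= r then y i else 0).
Proof.
move=> [E1 E2 E3]; split.
- by move=> i; case: ifP => [h /E1 //|]; rewrite eqxx.
- move=> q [Sq qr] q0; have [i iq] := E2 q Sq q0; exists i.
  by move: qr; rewrite /= -iq /= => ->.
- move=> i k; case: ifP => _; last by rewrite eqxx.
  by case: ifP => _; [exact: E3|rewrite eqxx].
Qed.

Lemma esum_enumerates S x y (g : R * R -> \bar R) : enumerates S x y ->
  (forall q, 0 <= g q)%E -> (forall q, q.2 = 0 -> g q = 0%E) ->
  \esum_(q in S) g q = (\sum_(i <oo) g (x i, y i))%E.
Proof.
move=> [E1 E2 E3] g0 gz.
pose I := [set i | y i != 0]; pose p i := (x i, y i).
have pI : p @` I = S `&` [set q | q.2 != 0].
  apply/seteqP; split=> [_ [i Ii <-]|q [Sq q0]]; first by split => //; exact: E1.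
  by have [i iq] := E2 q Sq q0; exists i => //; rewrite /I /= -[y i]/(x i, y i).2 iq.
have -> : \esum_(q in S) g q = \esum_(q in S `&` [set q | q.2 != 0]) g q.
  rewrite esum_mkcondr; apply: eq_esum => q _; case: ifPn => //.
  by rewrite notin_setE /= => /negP/negPn/eqP/gz.
rewrite -pI esum_image; last first.
  move=> i k; rewrite !inE => Ii Ik [e1 e2]; exact: E3.
rewrite esum_mkcond nneseries_esumT//; apply: eq_esum => i _.
by case: ifPn => //; rewrite notin_setE /= => /negP/negPn/eqP/(gz (p i)).
Qed.

Lemma nneseries_rsum (u : nat -> R) : asum u -> (forall i, 0 <= u i) ->
  (\sum_(i <oo) (u i)%:E)%E = (rsum u)%:E.
Proof.
move=> /asum_cvg cu u0; rewrite /rsum -EFin_lim//; congr (limn _).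
by apply/funext => n; rewrite /= seriesEnat /= sumEFin.
Qed.

Lemma asum_nneseries (u : nat -> R) : (forall i, 0 <= u i) ->
  (\sum_(i <oo) (u i)%:E < +oo)%E -> asum u.
Proof.
move=> u0 uoo; rewrite /asum (_ : (fun i => _) = u).
  exact: nnseries_is_cvg.
by apply/funext => i; rewrite ger0_norm.
Qed.

Lemma esum_posneg S x y (h : R * R -> R) : enumerates S x y ->
  (forall q, q.2 = 0 -> h q = 0) -> asum (fun i => h (x i, y i)) ->
  summable S (EFin \o h) /\
  (\esum_(q in S) (EFin \o h)^\+ q - \esum_(q in S) (EFin \o h)^\- q =
    (rsum (fun i => h (x i, y i)))%:E)%E.
Proof.
move=> ES h0 ah; pose u i := h (x i, y i).
have E1 : (EFin \o h)^\+%E = (fun q => (Num.max (h q) 0)%:E).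
  by apply/funext => q; rewrite funeposE /= -EFin_max.
have E2 : (EFin \o h)^\-%E = (fun q => (Num.max (- h q) 0)%:E).
  by apply/funext => q; rewrite funenegE /= -EFin_max.
have up : asum (fun i => Num.max (u i) 0).
  apply: asum_le ah _ => i; rewrite /u; case: (leP (h _) 0) => //.
  by rewrite normr0.
have um : asum (fun i => Num.max (- u i) 0).
  apply: asum_le ah _ => i; rewrite /u; case: (leP (- h _) 0) => //.
    by rewrite normr0.
  by rewrite normrN.
split.
  rewrite /summable (esum_enumerates ES)//; last by move=> q /h0 /= ->; rewrite normr0.
  rewrite (_ : (\sum_(i <oo) _)%E = (\sum_(i <oo) (`|u i|)%:E)%E)//.
  rewrite nneseries_rsum ?ltry//.
  by apply: asum_le ah _ => i; rewrite normr_id.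
rewrite E1 E2 !(esum_enumerates ES); last 4 first.
- by move=> q; rewrite lee_fin le_max lexx orbT.
- by move=> q /h0 ->; rewrite oppr0 maxxx.
- by move=> q; rewrite lee_fin le_max lexx orbT.
- by move=> q /h0 ->; rewrite maxxx.
rewrite (nneseries_rsum up); last by move=> i; rewrite le_max lexx orbT.
rewrite (nneseries_rsum um); last by move=> i; rewrite le_max lexx orbT.
rewrite -EFinB -rsumB//; congr EFin; apply: eq_rsum => i; rewrite -/(u i).
have [ui|ui] := leP (u i) 0.
  by rewrite (max_l (_ : 0 <= - u i)) ?oppr_ge0// sub0r opprK.
by rewrite (max_r (_ : - u i <= 0)) ?subr0// oppr_le0 ltW.
Qed.

End Enumeration.

Section JumpEquation.
Context {R : realType}.
Variables (t0 t1 a0 : R) (alpha : R -> R) (D : R -> R).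
Hypotheses (D0 : forall y, 0 <= D y) (D00 : D 0 = 0)
  (AD : forall y z, `|amplitude alpha y z| <= D y)
  (AL : forall y z z', `|amplitude alpha y z - amplitude alpha y z'| <=
      D y * `|z - z'|).

Lemma amplitude0 z : amplitude alpha 0 z = 0.
Proof. exact: signed_pow0. Qed.

Let F y := amplitude alpha y.

Section Configuration.
Variables (S : set (R * R)) (x y : nat -> R).
Hypotheses (ES : enumerates S x y) (aD : asum (fun i => D (y i)))
  (xt : forall i, t0 < x i < t1).

Let G i := F (y i).

Let GD i z : `|G i z| <= D (y i).
Proof. exact: AD. Qed.

(** Whatever [f] is, the sum converges absolutely, because the amplitudes are
    dominated uniformly in the state. *)
Lemma jump_equationE f : jump_equation t0 t1 a0 alpha S f <->
  forall t, t0 <= t < t1 -> f t = jump_path x G a0 (fun i => left_limit f (x i)) t.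
Proof.
have key t : t0 <= t < t1 ->
  summable S (jump_term t0 alpha f t) /\
  (a0%:E + (\esum_(p in S) (jump_term t0 alpha f t)^\+ p -
            \esum_(p in S) (jump_term t0 alpha f t)^\- p))%E =
  (jump_path x G a0 (fun i => left_limit f (x i)) t)%:E.
  move=> tt; pose h (q : R * R) := \1_(`]t0, t]%classic) q.1 *
    amplitude alpha q.2 (left_limit f q.1).
  have hE i : h (x i, y i) = (x i <= t)%R%:R * G i (left_limit f (x i)).
    rewrite /h /= indicE; congr (_ * _); congr (_%:R);
      congr nat_of_bool; apply/idP/idP.
      by rewrite inE /= in_itv /= => /andP[].
    by rewrite inE /= in_itv /= => ->; case/andP: (xt i) => ->.
  have [||s e] := @esum_posneg R S x y h ES.
  - by move=> q q0; rewrite /h q0 amplitude0 mulr0.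
  - rewrite (funext hE); apply: asum_mask.
    exact: (@asum_jump _ _ aD G (fun i => left_limit f (x i)) GD).
  - split; first exact: s.
    by rewrite [X in (_ + X)%E]e (funext hE) -EFinD.
split=> H t tt; have [s e] := key t tt.
  by have [_] := H t tt; rewrite e => -[].
by split => //; rewrite e H.
Qed.

(** At a jump time [u = x i] this is the equation for the unknown [z i]: solving
    the jump equation amounts to solving the system for the left limits. *)
Lemma jump_path_left_limit f z u : t0 < u <= t1 ->
  (forall t, t0 <= t < t1 -> f t = jump_path x G a0 z t) ->
  f t @[t --> u^'-] --> a0 + rsum (fun j => (x j < u)%R%:R * G j (z j)).
Proof.
move=> /andP[u0 u1] fE.
have h := @jump_path_left _ x _ aD G a0 z u GD.
apply: cvg_trans h; apply: near_eq_cvg; near=> t; rewrite fE//.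
apply/andP; split; first by apply: ltW; near: t; exact: nbhs_left_gt.
by apply: lt_le_trans u1; near: t; exact: nbhs_left_lt.
Unshelve. all: by end_near. Qed.

Lemma jump_path_cadlag f z :
  (forall t, t0 <= t < t1 -> f t = jump_path x G a0 z t) -> cadlag t0 t1 f.
Proof.
move=> fE; split=> u; last first.
  by move=> uu; apply/cvg_ex; eexists; exact: (jump_path_left_limit uu fE).
move=> /andP[u0 u1]; rewrite fE ?u0//.
have h := @jump_path_right _ x _ aD G a0 z u GD.
apply: cvg_trans h; apply: near_eq_cvg; near=> t; rewrite fE//.
apply/andP; split; first by apply: (le_trans u0); apply: ltW; near: t; exact: nbhs_right_gt.
by near: t; exact: nbhs_right_lt.
Unshelve. all: by end_near. Qed.

Lemma jump_path_equation f z : jump_solution x G a0 z ->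
  (forall t, t0 <= t < t1 -> f t = jump_path x G a0 z t) ->
  jump_equation t0 t1 a0 alpha S f.
Proof.
move=> zP fE; apply/jump_equationE => t tt; rewrite fE// /jump_path.
congr (_ + _); apply: eq_rsum => i; congr (_ * G i _).
have xi : t0 < x i <= t1 by case/andP: (xt i) => -> /ltW ->.
by rewrite zP; apply/esym/cvg_lim => //; exact: jump_path_left_limit.
Qed.

Lemma jump_equation_path f : jump_equation t0 t1 a0 alpha S f ->
  jump_solution x G a0 (fun i => left_limit f (x i)) /\
  forall t, t0 <= t < t1 -> f t = jump_path x G a0 (fun i => left_limit f (x i)) t.
Proof.
move=> /jump_equationE fE; split => // i.
have xi : t0 < x i <= t1 by case/andP: (xt i) => -> /ltW ->.
by apply/cvg_lim => //; exact: jump_path_left_limit.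
Qed.

End Configuration.

Section Truncation.
Variables (S : set (R * R)) (x y : nat -> R).
Hypotheses (ES : enumerates S x y) (aD : asum (fun i => D (y i)))
  (xt : forall i, t0 < x i < t1).

Let yn n i : R := if `|y i| <= n%:R then y i else 0.

Let D_yn n i : D (yn n i) <= D (y i).
Proof. by rewrite /yn; case: ifP => // _; rewrite D00. Qed.

Lemma asum_trunc n : asum (fun i => D (yn n i)).
Proof. by apply: asum_le aD _ => i; rewrite !ger0_norm ?D0. Qed.

Lemma jump_equation_exists : exists f, jump_equation t0 t1 a0 alpha S f.
Proof.
have [z zP] := jump_solution_exists x (fun i => D0 (y i)) aD
  (fun i => AD (y i)) (fun i => AL (y i)) a0.
by exists (jump_path x (fun i => F (y i)) a0 z); exact: (jump_path_equation ES aD xt zP).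
Qed.

(** The error made by discarding the marks beyond [n] is a tail of the
    dominating series, up to the stability constant. *)
Lemma truncation_cvg z (f : nat -> R -> R) g :
  jump_solution x (fun i => F (y i)) a0 z -> t0 < t1 ->
  (forall t, t0 <= t < t1 -> g t = jump_path x (fun i => F (y i)) a0 z t) ->
  (forall n, jump_equation t0 t1 a0 alpha
     (S `&` [set p | `|p.2| <= n%:R]) (f n)) ->
  sup_norm t0 t1 (fun t => f n t - g t) @[n --> \oo] --> 0%E.
Proof.
move=> zP t01 gE fP.
pose e n i := D (y i) - D (yn n i).
have ae n : asum (e n) by apply: asumB => //; exact: asum_trunc.
have e0 n i : 0 <= e n i by rewrite subr_ge0.
pose L := rsum (fun i => D (y i)).
pose K := 1 + L * (expR (2 * L) * 2).
have K0 : 0 <= K.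
  by rewrite addr_ge0// !mulr_ge0 ?expR_ge0// rsum_ge0.
have fg n t : t0 <= t < t1 -> `|f n t - g t| <= K * rsum (e n).
  move=> tt.
  have [fs ->] := jump_equation_path (enumerates_trunc n%:R ES) (@asum_trunc n)
    xt (fP n); last by [].
  rewrite gE//.
  apply: (@jump_stability _ x _ (fun i => D0 (y i)) aD _ (fun i => AD (y i))
    (fun i => AL (y i)) _ a0 z _ (e n)) => //.
    by move=> i u; apply: (le_trans (AD _ _)); exact: D_yn.
  move=> i; rewrite /e /yn /F; case: ifP => _; first by rewrite !subrr normr0.
  by rewrite amplitude0 D00 subr0 sub0r normrN; exact: AD.
have ce : K * rsum (e n) @[n --> \oo] --> 0.
  rewrite -[0](mulr0 K); apply: cvgMr; rewrite -(@rsum0 R).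
  apply: (tannery aD).
    by apply: nearW => n i; rewrite ger0_norm// /e lerBlDr lerDl.
  move=> i; apply: cvg_near_cst; near=> n; rewrite /e /yn ifT ?subrr//.
  by near: n; have /cvgryPge := @cvgr_idn R; exact.
have s0 n : (0 <= sup_norm t0 t1 (fun t => (f n t - g t)%R))%E.
  apply: (@le_trans _ _ (`|f n t0 - g t0|%R)%:E); first by rewrite lee_fin.
  by apply: ereal_sup_ubound; exists t0 => //=; rewrite in_itv /= lexx t01.
apply: (@squeeze_cvge _ _ _ _ (fun=> 0%E) _ (fun n => (K * rsum (e n))%:E)).
- apply: nearW => n; rewrite s0 /=; apply: ge_ereal_sup => _ [t /= tt <-].
  by rewrite lee_fin; apply: fg; rewrite in_itv /= in tt.
- exact: cvg_cst.
- by apply: cvg_EFin => //; exact: nearW.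
Unshelve. all: by end_near. Qed.

End Truncation.

End JumpEquation.
(** * Almost sure summability over a Poisson point process *)

Section PoissonMean.
Context d (T : measurableType d) (R : realType) (P : probability T R).
Local Open Scope ereal_scope.

Lemma sum_poisson_pmf (r : R) : (0 < r)%R ->
  \sum_(k <oo) (poisson_pmf r k)%:E = 1.
Proof.
move=> r0; rewrite nneseries_esumT; last by move=> k; rewrite lee_fin poisson_pmf_ge0.
rewrite -(@probability_setT _ _ R (poisson_prob r 0%N)) /=.
by rewrite /poisson_prob r0.
Qed.

Lemma mean_poisson_pmf (r : R) : (0 < r)%R ->
  \sum_(k <oo) (k%:R * poisson_pmf r k)%:E = r%:E.
Proof.
move=> r0; rewrite nneseries_recl//; last first.
  by move=> k _; rewrite lee_fin mulr_ge0// poisson_pmf_ge0.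
rewrite mul0r add0e -(@nneseries_addn _ (fun k => (k%:R * poisson_pmf r k)%:E) 1%N)//;
  last by move=> k; rewrite lee_fin mulr_ge0// poisson_pmf_ge0.
rewrite (eq_eseriesr (g := fun k => r%:E * (poisson_pmf r k)%:E)); last first.
  move=> k _; rewrite -EFinM; congr EFin; rewrite /poisson_pmf r0 addn1.
  rewrite factS natrM exprS; field.
  by rewrite !pnatr_eq0 -lt0n fact_gt0 /=.
rewrite nneseriesZl ?sum_poisson_pmf ?mule1//.
by move=> k _; rewrite lee_fin poisson_pmf_ge0.
Qed.

(** A Poisson variable is a.s. a natural number, so it is a.s. the sum of the
    variables [k 1_{N = k}]. *)
Lemma poisson_mean (N : T -> \bar R) (r : R) : (0 < r)%R ->
  measurable_fun setT N -> (forall w, 0 <= N w) -> poisson_law P N r%:E ->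
  \int[P]_w N w = r%:E.
Proof.
move=> r0 mN N0 Nr.
pose A k := N @^-1` [set k%:R%:E].
have mA k : measurable (A k).
  by rewrite -[A k]setTI; apply: mN => //; exact: emeasurable_set1.
have PA k : P (A k) = (poisson_pmf r k)%:E.
  rewrite (_ : A k = [set w | N w = k%:R%:E])// Nr /poisson_prob r0.
  by rewrite esum_set1// lee_fin poisson_pmf_ge0.
have tA : trivIset setT A.
  apply/trivIsetP => i j _ _ ij; apply/seteqP; split=> // w [].
  rewrite /A /= => -> []/eqP; rewrite eqr_nat => /eqP e.
  by move: ij; rewrite e eqxx.
have AT : P (~` \bigcup_k A k) = 0.
  rewrite probability_setC; last exact: bigcup_measurable.
  rewrite measure_bigcup// (eq_eseriesr (g := fun k => (poisson_pmf r k)%:E));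
    last by move=> k _; exact: PA.
  by rewrite (eq_eseriesl (Q := xpredT)) ?sum_poisson_pmf ?subee// => k; rewrite in_setT.
pose g w := \sum_(k <oo) (k%:R * \1_(A k) w : R)%R%:E.
have g0 k w : 0 <= (k%:R * \1_(A k) w : R)%R%:E by rewrite lee_fin mulr_ge0.
have mg k : measurable_fun setT (fun w => (k%:R * \1_(A k) w : R)%R%:E).
  by apply/measurable_EFinP; apply: measurable_funM => //; exact: measurable_indic.
have intg : \int[P]_w g w = r%:E.
  rewrite /g integral_nneseries// -(mean_poisson_pmf r0).
  apply: eq_eseriesr => k _.
  rewrite (@integralZl_indic _ _ _ P _ _ (fun=> A k))//; last by rewrite ltNge ler0n.
  by rewrite integral_indic// setIT [X in _ * X]PA.
rewrite -intg; apply: ge0_ae_eq_integral => //.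
- exact: ge0_emeasurable_sum.
- by move=> w _; apply: nneseries_ge0.
- exists (~` \bigcup_k A k); split => //.
    by apply: measurableC; exact: bigcup_measurable.
  move=> w /= Ng [k _ Akw]; apply: Ng => _.
  rewrite /g (nneseriesD1 (n := k))// eseries0 ?adde0.
    by rewrite indicE mem_set// mulr1.
  move=> j _ /= jk; rewrite indicE memNset ?mulr0// => Ajw.
  move/trivIsetP : tA => /(_ k j I I); rewrite eq_sym jk => /(_ isT)/seteqP[/(_ w)] h _.
  by apply: h.
Qed.

End PoissonMean.

Section Counting.
Context {R : realType}.

Lemma esum_counting (S A : set (R * R)) :
  (\esum_(q in S) (\1_A q)%:E <= @counting _ R (S `&` A))%E.
Proof.
rewrite /counting; case: asboolP => [fin|_]; last by rewrite leey.
rewrite (_ : \esum_(q in S) _ = \esum_(q in S `&` A) 1%:E); last first.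
  rewrite esum_mkcondr; apply: eq_esum => q _.
  by rewrite indicE; case: (q \in A).
rewrite esum_fset// fsumEFin// lee_fin fsbig_finite//= big_const_seq count_predT.
by rewrite iter_addr_0 -mulr_natr mul1r.
Qed.

Definition disc (r : R) : set (R * R) := [set q | `|q.2| < r].

Lemma dyadic_shell (r : R) : 1 <= r -> exists k, 2 ^+ k <= r < 2 ^+ k.+1.
Proof.
move=> r1.
have ex : exists k, r < 2 ^+ k.
  exists (Num.bound r); have r0 : 0 <= r by exact: le_trans r1.
  apply: (lt_le_trans (archi_boundP r0)).
  by rewrite -natrX ler_nat ltnW// ltn_expl.
have := ex_minnP ex; case=> -[|k] rk kmin.
  by move: rk; rewrite expr0 ltNge r1.
exists k; rewrite rk andbT leNgt; apply/negP => /kmin.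
by rewrite ltnn.
Qed.

(** A point with mark in the shell from [2 ^ k] to [2 ^ k.+1] contributes at most
    [D (2 ^ k)], and is counted in the disc of radius [2 ^ k.+1]. *)
Lemma asum_majorant (D : R -> R) (S : set (R * R)) x y :
  enumerates S x y ->
  D 0 = 0 -> (forall u, 0 <= D u) ->
  (forall u v, u != 0 -> `|u| <= `|v| -> D v <= D u) ->
  (@counting _ R (S `&` disc 1) < +oo)%E ->
  (\sum_(k <oo) (D (2 ^+ k))%:E * @counting _ R (S `&` disc (2 ^+ k.+1)) < +oo)%E ->
  asum (fun i => D (y i)).
Proof.
move=> ES D00 D0 anti fin0 fin.
have small : asum (fun i => \1_(disc 1) (x i, y i) * D (y i)).
  apply: asum_nneseries => [i|]; first by rewrite mulr_ge0.
  rewrite -(esum_enumerates (g := fun q => (\1_(disc 1) q * D q.2)%:E) ES)//.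
  - rewrite (_ : \esum_(q in S) _ = \esum_(q in S `&` disc 1) (D q.2)%:E).
      have fS : finite_set (S `&` disc 1).
        by move: fin0; rewrite /counting; case: asboolP.
      by rewrite esum_fset ?fsumEFin ?ltry// => q _; rewrite lee_fin.
    rewrite esum_mkcondr; apply: eq_esum => q _; rewrite indicE.
    by case: (q \in disc 1); rewrite ?mul1r ?mul0r.
  - by move=> q; rewrite lee_fin mulr_ge0.
  - by move=> q ->; rewrite D00 mulr0.
pose h (q : R * R) k := (D (2 ^+ k) * (q.2 != 0)%:R * \1_(disc (2 ^+ k.+1)) q)%:E.
have h0 q k : (0 <= h q k)%E by rewrite lee_fin !mulr_ge0.
have large : asum (fun i => \1_(~` disc 1) (x i, y i) * D (y i)).
  apply: asum_nneseries => [i|]; first by rewrite mulr_ge0.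
  apply: (@le_lt_trans _ _ (\sum_(i <oo) \sum_(k <oo) h (x i, y i) k)%E).
    apply: lee_nneseries => i; first by rewrite lee_fin mulr_ge0.
    move=> _; rewrite indicE.
    have [y1|y1] := ltP `|y i| 1.
      rewrite memNset ?mul0r; last by move=> /=; apply; rewrite /disc /=.
      by apply: nneseries_ge0 => k _ _.
    have y0 : y i != 0 by rewrite -normr_gt0 (lt_le_trans ltr01).
    have [k /andP[k1 k2]] := dyadic_shell y1.
    rewrite mem_set ?mul1r; last by rewrite /disc /= ltNge y1.
    rewrite (nneseriesD1 (n := k))//.
    apply: (@le_trans _ _ (h (x i, y i) k)).
      rewrite /h indicE mem_set// y0 !mulr1 lee_fin anti ?expf_neq0//.
      by rewrite ger0_norm// exprn_ge0.
    by rewrite leeDl// nneseries_ge0.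
  rewrite nneseries_interchange//; apply: le_lt_trans fin.
  apply: lee_nneseries => k; first by move=> _ _; apply: nneseries_ge0 => *; exact: h0.
  move=> _; pose c (q : R * R) := ((q.2 != 0)%:R * \1_(disc (2 ^+ k.+1)) q : R)%:E.
  have c0 q : (0 <= c q)%E by rewrite lee_fin mulr_ge0.
  rewrite (eq_eseriesr (g := fun i => (D (2 ^+ k))%:E * c (x i, y i))%E); last first.
    by move=> i _; rewrite /h /c -EFinM mulrA.
  rewrite nneseriesZl// lee_wpmul2l ?lee_fin//.
  rewrite -(esum_enumerates (g := c) ES)//; last first.
    by move=> q q0; rewrite /c q0 eqxx mul0r.
  apply: le_trans (esum_counting _ _); apply: le_esum => q _.
  by rewrite /c lee_fin; case: (_ != _); rewrite ?mul1r// mul0r.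
apply: (@eq_asum _ (fun i => \1_(disc 1) (x i, y i) * D (y i) +
  \1_(~` disc 1) (x i, y i) * D (y i))); last exact: asumD.
move=> i; rewrite -mulrDl !indicE in_setC.
by case: (_ \in _); rewrite ?addr0 ?add0r mul1r.
Qed.

End Counting.

Section PoissonSummable.
Context d (T : measurableType d) (R : realType) (P : probability T R).
Variables (t0 t1 : R) (Pi : T -> set (measurableTypeR R * measurableTypeR R)).
Hypotheses (t01 : t0 < t1)
  (hPi : poisson_point_process P (lebesgue_strip t0 t1) Pi).

Lemma measurable_disc (r : R) :
  measurable (disc r : set (measurableTypeR R * measurableTypeR R)).
Proof.
rewrite (_ : disc r = setT `*` `]- r, r[%classic).
  by apply: measurableX => //; exact: measurable_itv.
by apply/seteqP; split=> -[u v] /=; rewrite /disc /= in_itv /= ltr_norml => // -[].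
Qed.

Lemma lebesgue_strip_disc (r : R) : 0 < r ->
  lebesgue_strip t0 t1 (disc r) = ((t1 - t0) * (2 * r))%:E.
Proof.
move=> r0; rewrite /lebesgue_strip.
have -> : disc r `&` strip t0 t1 = `]t0, t1[%classic `*` `]- r, r[%classic.
  apply/seteqP; split=> -[u v]; rewrite /disc /strip /= !in_itv /= ltr_norml.
    by move=> [-> [-> _]].
  by move=> [-> ->].
rewrite product_measure1E; [|exact: measurable_itv..].
transitivity (lebesgue_measure (`]t0, t1[%classic : set R) *
  lebesgue_measure (`](- r)%R, r[%classic : set R))%E => //.
rewrite !lebesgue_measure_itv /= !lte_fin t01 gtrN// -!EFinB -EFinM.
by congr EFin; ring.
Qed.

Lemma measurable_count (A : set (measurableTypeR R * measurableTypeR R)) :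
  measurable A -> measurable_fun setT (point_count R Pi A).
Proof. by case: hPi => _ /(_ A) h _ /h[]. Qed.

Lemma count_disc_mean (r : R) : 0 < r ->
  (\int[P]_w point_count R Pi (disc r) w = ((t1 - t0) * (2 * r))%:E)%E.
Proof.
move=> r0; apply: poisson_mean.
- by rewrite !mulr_gt0// subr_gt0.
- exact: measurable_count (measurable_disc r).
- by move=> w; rewrite /point_count; exact: measure_ge0.
- case: hPi => _ /(_ _ (measurable_disc r))[_ + _].
  by rewrite lebesgue_strip_disc.
Qed.

(** The mean number of points with marks below [2 ^ k] is proportional to
    [2 ^ k], so the expectation of a dyadic majorant of the sum is finite. *)
Lemma poisson_summable (D : R -> R) : D 0 = 0 -> (forall u, 0 <= D u) ->
  (forall u v, u != 0 -> `|u| <= `|v| -> D v <= D u) ->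
  asum (fun k => 2 ^+ k * D (2 ^+ k)) ->
  {ae P, forall w, forall x y, enumerates (Pi w) x y -> asum (fun i => D (y i))}.
Proof.
move=> D00 D0 anti sD.
pose N r w := point_count R Pi (disc r) w.
have N0 r w : (0 <= N r w)%E by exact: measure_ge0.
have mN r : measurable_fun setT (N r) by exact: measurable_count (measurable_disc r).
pose V w := (N 1%R w + \sum_(k <oo) (D (2 ^+ k)%R)%:E * N (2 ^+ k.+1)%R w)%E.
have DN0 k w : (0 <= (D (2 ^+ k)%R)%:E * N (2 ^+ k.+1)%R w)%E.
  by rewrite mule_ge0// lee_fin.
have mDN k : measurable_fun setT (fun w => (D (2 ^+ k)%R)%:E * N (2 ^+ k.+1)%R w)%E.
  by apply: emeasurable_funM => //; exact: measurable_cst.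
have mV1 : measurable_fun setT (fun w => \sum_(k <oo) (D (2 ^+ k)%R)%:E * N (2 ^+ k.+1)%R w)%E.
  exact: ge0_emeasurable_sum.
have V10 w : (0 <= \sum_(k <oo) (D (2 ^+ k)%R)%:E * N (2 ^+ k.+1)%R w)%E.
  exact: nneseries_ge0.
have mV : measurable_fun setT V by exact: emeasurable_funD.
have iV : (\int[P]_w V w < +oo)%E.
  rewrite ge0_integralD// count_disc_mean// integral_nneseries//.
  rewrite (eq_eseriesr (g := fun k =>
      ((t1 - t0) * 4 * (2 ^+ k * D (2 ^+ k)))%:E)); last first.
    move=> k _; rewrite ge0_integralZl// ?lee_fin// count_disc_mean ?exprn_gt0//.
    by rewrite -EFinM; congr EFin; rewrite exprS; ring.
  rewrite nneseries_rsum; first by rewrite -EFinD ltry.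
    exact: asumZ.
  by move=> k; rewrite !mulr_ge0// ?subr_ge0 ?exprn_ge0// ltW.
have intV : P.-integrable setT V.
  apply/integrableP; split => //.
  under eq_integral do rewrite gee0_abs ?adde_ge0//.
  exact: iV.
have := integrable_ae measurableT intV.
apply: filterS => w /(_ I) Vw x y Exy.
have Vlt : (V w < +oo)%E by rewrite ltey_eq Vw.
apply: (asum_majorant Exy) => //.
  by apply: le_lt_trans Vlt; rewrite /V leeDl.
by apply: le_lt_trans Vlt; rewrite /V leeDr.
Qed.

End PoissonSummable.
(** * Measurability of the Euler scheme and of its limit *)

Section Flow.
Context {R : realType}.
Implicit Types (S A : set (measurableTypeR R * measurableTypeR R)).

(** Points with zero mark carry no jump, and are ignored. *)
Definition hit S A : bool := `[< exists q, [/\ S q, q.2 != 0 & A q] >].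

Lemma hits_enumerates S x y : enumerates S x y -> hits x y = hit S.
Proof.
move=> [E1 E2 _]; apply/funext => A; apply/asboolP/asboolP.
  by move=> [i [yi Ai]]; exists (x i, y i); split => //; exact: E1.
move=> [q [Sq q0 Aq]]; have [i iq] := E2 q Sq q0; exists i.
by rewrite -[y i]/(x i, y i).2 iq.
Qed.

(** The upper limit is a total measurable function of the avoidance events; it is
    the limit of the scheme for almost every configuration. *)
Definition flow (F : R -> R -> R) s t (h : set (R * R) -> bool) z : R :=
  fine (limn_esup (fun m => (euler F m s t h z)%:E)).

Lemma flow_jump_path (F : R -> R -> R) (D : R -> R) S x y a0 zeta s t :
  enumerates S x y -> (forall u, 0 <= D u) -> asum (fun i => D (y i)) ->
  (forall z, F 0 z = 0) -> (forall u z, `|F u z| <= D u) ->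
  (forall u z z', `|F u z - F u z'| <= D u * `|z - z'|) ->
  (forall u v, u != 0 -> `|u| <= `|v| -> D v <= D u) ->
  (forall u z, u != 0 -> F v z @[v --> u] --> F u z) ->
  jump_solution x (fun i => F (y i)) a0 zeta -> s <= t ->
  flow F s t (hit S) (jump_path x (fun i => F (y i)) a0 zeta s) =
  jump_path x (fun i => F (y i)) a0 zeta t.
Proof.
move=> ES D0 aD F0 FD FL anti Fc zP st; rewrite -(hits_enumerates ES).
have c := @cvg_euler R F x y (fun i => D (y i)) (fun i => D0 (y i)) aD F0
  _ _ (fun i => Fc (y i)) _ a0 zeta s t zP st.
have {}c := c (fun i v z yi yv => le_trans (FD v z) (anti _ _ yi yv)).
have {}c := c (fun i v z z' yi yv => le_trans (FL v z z')
  (ler_wpM2r (normr_ge0 _) (anti _ _ yi yv))).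
have {}c : euler F m s t (hits x y) (jump_path x (fun i => F (y i)) a0 zeta s)
    @[m --> \oo] --> jump_path x (fun i => F (y i)) a0 zeta t.
  by apply: c; case: ES.
have e : (euler F m s t (hits x y)
    (jump_path x (fun i => F (y i)) a0 zeta s))%:E @[m --> \oo] -->
    (jump_path x (fun i => F (y i)) a0 zeta t)%:E.
  by apply: cvg_EFin => //; exact: nearW.
rewrite /flow is_cvg_limn_esupE; first by rewrite (cvg_lim _ e).
by apply/cvg_ex; eexists; exact: e.
Qed.

Lemma measurable_jump_box m (s t : R) j c :
  measurable (jump_box m s t j c : set (measurableTypeR R * measurableTypeR R)).
Proof.
rewrite (_ : jump_box m s t j c =
  `]grid_time m s t j, grid_time m s t j.+1]%classic `*`
  (`](c - 1)%:~R / m.+1%:R, c%:~R / m.+1%:R]%classic `\ 0)).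
  apply: measurableX; first exact: measurable_itv.
  by apply: measurableD; [exact: measurable_itv|exact: measurable_set1].
apply/seteqP; split=> -[u v]; rewrite /jump_box /= !in_itv /=.
  by move=> [-> [v0 ->]]; split => //; split => //; apply/eqP.
by move=> [-> [-> /eqP v0]].
Qed.

Lemma measurable_euler d (U : measurableType d) (F : R -> R -> R)
    (h : U -> set (R * R) -> bool) (z : U -> R) m s t :
  (forall v, measurable_fun setT (F v)) -> measurable_fun setT z -> s <= t ->
  (forall A, measurable A -> A `<=` [set q | s < q.1 <= t] ->
     measurable [set u | h u A]) ->
  measurable_fun setT (fun u => euler F m s t (h u) (z u)).
Proof.
move=> mF mz st mh; rewrite /euler.
suff H j : (j <= m.+1)%N ->
    measurable_fun setT (fun u => euler_iter F m s t (h u) (z u) j) by exact: H.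
elim: j => [//|j IH] jm; have {}IH := IH (ltnW jm).
apply: measurable_funD => //; apply: measurable_sum => k.
apply: measurable_funM; last exact: measurableT_comp.
rewrite (_ : (fun u => _) =
  \1_[set u | h u (jump_box m s t j (cell_index m k))]); last first.
  apply/funext => u; rewrite indicE; congr (_%:R); congr nat_of_bool.
  by apply/idP/idP; rewrite inE.
apply: measurable_indic; apply: mh; first exact: measurable_jump_box.
move=> q [/andP[q1 q2] _] /=.
have [h1 h2] := @ler_grid_time R m s t j st jm.
by rewrite (le_lt_trans h1 q1) (le_trans q2 h2).
Qed.

(** The initial state and the configuration may both depend on the parameter: on
    a product space this gives the joint measurability in (state, future). *)
Lemma measurable_flow d (U : measurableType d) (F : R -> R -> R)
    (h : U -> set (R * R) -> bool) (z : U -> R) s t :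
  (forall v, measurable_fun setT (F v)) -> measurable_fun setT z -> s <= t ->
  (forall A, measurable A -> A `<=` [set q | s < q.1 <= t] ->
     measurable [set u | h u A]) ->
  measurable_fun setT (fun u => flow F s t (h u) (z u)).
Proof.
move=> mF mz st mh.
apply: (measurableT_comp (fine_measurable (@measurableT _ (\bar R)))).
apply: measurable_fun_limn_esup => m.
by apply/measurable_EFinP; exact: measurable_euler.
Qed.

End Flow.

(** * Independence of the past and the future *)

Section Independence.
Context d (T : measurableType d) (R : realType) (P : probability T R).
Local Open Scope ereal_scope.

Lemma dynkin_indep (F : set T) : measurable F ->
  dynkin [set E | measurable E /\ P (E `&` F) = P E * P F].
Proof.
move=> mF; split => [|E [mE EF]|A tA AF].
- by split => //; rewrite setTI probability_setT mul1e.
- split; first exact: measurableC.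
  have -> : ~` E `&` F = F `\` (E `&` F).
    apply/seteqP; split=> w /=; first by move=> [nE Fw]; split => // -[].
    by move=> [Fw nEF]; split => // Ew; apply: nEF.
  rewrite measureD//; last 2 first.
  - exact: measurableI.
  - by rewrite ltey_eq fin_num_measure.
  have EF' : P (F `&` (E `&` F)) = P E * P F by rewrite setICA setIid.
  rewrite [X in _ - X]EF' probability_setC//.
  have arith (p q : \bar R) : p \is a fin_num -> q \is a fin_num ->
      q - p * q = (1 - p) * q.
    case: p q => [p| |] [q| |]// _ _.
    by rewrite -EFinM -!EFinB -EFinM; congr EFin; ring.
  by apply: arith; exact: fin_num_measure.
- have mA k : measurable (A k) by case: (AF k).
  split; first exact: bigcup_measurable.
  rewrite setI_bigcupl measure_bigcup//; last 2 first.
  - by move=> k _; exact: measurableI.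
  - exact: trivIset_setIr.
  rewrite measure_bigcup//.
  rewrite (eq_eseriesr (g := fun k => P F * P (A k))); last first.
    by move=> k _; case: (AF k) => _ e; rewrite muleC; exact: e.
  by rewrite -(fineK (fin_num_measure P F mF)) nneseriesZl// muleC.
Qed.

(** Two applications of the pi-lambda theorem. *)
Lemma indep_sigma (G H : set (set T)) :
  G `<=` measurable -> H `<=` measurable -> setI_closed G -> setI_closed H ->
  (forall A B, G A -> H B -> P (A `&` B) = P A * P B) ->
  forall A B, <<s G >> A -> <<s H >> B -> P (A `&` B) = P A * P B.
Proof.
move=> mG mH GI HI GH.
have half A B : <<s G >> A -> H B -> P (A `&` B) = P A * P B.
  move=> sA HB.
  have : [set E | measurable E /\ P (E `&` B) = P E * P B] A.
    apply: lambda_system_subset sA => //.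
      exact/dynkin_lambda_system/dynkin_indep/mH.
    by move=> E GE; split; [exact: mG|exact: GH].
  by case.
have sG A : <<s G >> A -> measurable A.
  by apply: smallest_sub => //; exact: sigma_algebra_measurable.
move=> A B sA sB.
have : [set E | measurable E /\ P (E `&` A) = P E * P A] B.
  apply: lambda_system_subset sB => //.
    exact/dynkin_lambda_system/dynkin_indep/sG.
  by move=> E HE; split; [exact: mH|rewrite setIC half// muleC].
by case=> _; rewrite setIC muleC.
Qed.

Lemma measurable_prob_xsection d1 (T1 : measurableType d1)
    d2 (T2 : measurableType d2) (X : T -> T2) (C : set (T1 * T2)) :
  measurable_fun setT X -> measurable C ->
  measurable_fun setT (fun x : T1 => P (X @^-1` xsection C x)).
Proof.
move=> mX mC.
pose Y : {mfun T >-> T2} := HB.pack X (isMeasurableFun.Build _ _ _ _ X mX).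
exact: (@measurable_fun_xsection _ _ T1 T2 R (distribution P Y) C mC).
Qed.

(** Freezing the first of two independent variables: their joint law is the
    product of their laws. *)
Lemma indep_freezing d1 (T1 : measurableType d1) d2 (T2 : measurableType d2)
    (X1 : T -> T1) (X2 : T -> T2) :
  measurable_fun setT X1 -> measurable_fun setT X2 ->
  (forall A B, measurable A -> measurable B ->
     P (X1 @^-1` A `&` X2 @^-1` B) = P (X1 @^-1` A) * P (X2 @^-1` B)) ->
  forall C : set (T1 * T2), measurable C ->
  P [set w | C (X1 w, X2 w)] = \int[P]_w P (X2 @^-1` xsection C (X1 w)).
Proof.
move=> mX1 mX2 ind C mC.
pose Y1 : {mfun T >-> T1} := HB.pack X1 (isMeasurableFun.Build _ _ _ _ X1 mX1).
pose Y2 : {mfun T >-> T2} := HB.pack X2 (isMeasurableFun.Build _ _ _ _ X2 mX2).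
have mX : measurable_fun setT (fun w => (X1 w, X2 w)) by exact: measurable_fun_pair.
pose Y : {mfun T >-> (T1 * T2)%type} :=
  HB.pack (fun w => (X1 w, X2 w)) (isMeasurableFun.Build _ _ _ _ _ mX).
have := @product_measure_unique _ _ T1 T2 R (distribution P Y1) (distribution P Y2)
  (distribution P Y) ind C mC.
rewrite /product_measure1 => e; rewrite [LHS](esym e).
apply: (@ge0_integral_distribution _ _ T T1 R P Y1
  (fun w1 : T1 => P (X2 @^-1` xsection C w1))) => //.
exact: measurable_prob_xsection.
Qed.

Lemma probability_ae (E E' : set T) : measurable E -> measurable E' ->
  {ae P, forall w, E w <-> E' w} -> P E = P E'.
Proof.
move=> mE mE' [N [mN N0 sN]].
have sub (A B : set T) : measurable A -> measurable B ->
    (forall w, ~ N w -> A w -> B w) -> P A <= P B.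
  move=> mA mB AB; apply: (@le_trans _ _ (P (B `|` N))).
    apply: le_measure; rewrite ?inE//; first exact: measurableU.
    by move=> w Aw; have [|nN] := pselect (N w); [right|left; exact: AB].
  by have := measureU2 P mB mN; rewrite [X in _ + X]N0 adde0.
have EE w : ~ N w -> (E w <-> E' w).
  by move=> nN; apply: contrapT => h; apply: nN; exact: sN.
by apply/eqP; rewrite eq_le !sub// => w /EE[].
Qed.

End Independence.

Section PastFuture.
Context d (T : measurableType d) (R : realType) (P : probability T R).
Variables (t0 t1 : R) (Pi : T -> set (measurableTypeR R * measurableTypeR R)).
Hypothesis hPi : poisson_point_process P (lebesgue_strip t0 t1) Pi.
Notation E := (measurableTypeR R * measurableTypeR R)%type.

Definition void (A : set E) : set T := [set w | ~~ hit (Pi w) A].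

Let marked (A : set E) : set E := A `&` [set q | q.2 != 0].

Let measurable_marked A : measurable A -> measurable (marked A).
Proof.
move=> mA; apply: measurableI => //.
rewrite (_ : [set q | _] = setT `*` (~` [set 0])).
  by apply: measurableX => //; apply: measurableC; exact: measurable_set1.
by apply/seteqP; split=> -[u v] /=; [move=> /eqP|move=> [_ /eqP]].
Qed.

Let voidE A : void A = point_count R Pi (marked A) @^-1` [set 0%E].
Proof.
apply/seteqP; split=> w; rewrite /void /point_count /=.
  move=> /asboolPn h; have -> : Pi w `&` marked A = set0; last exact: measure0.
  by rewrite -subset0 => q [Pq [Aq q0]]; apply: h; exists q.
rewrite /counting; case: asboolP => [fin|//] [] /eqP.
rewrite pnatr_eq0 finmap.cardfs_eq0 => /eqP /(fset_set_set0 fin) h.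
apply/asboolPn => -[q [Pq q0 Aq]].
have : (Pi w `&` marked A) q by split.
by rewrite h.
Qed.

Lemma measurable_void A : measurable A -> measurable (void A).
Proof.
move=> mA; rewrite voidE -[X in measurable X]setTI.
case: hPi => _ /(_ _ (measurable_marked mA))[mN _] _.
by apply: mN => //; exact: emeasurable_set1.
Qed.

Lemma voidU A B : void A `&` void B = void (A `|` B).
Proof.
apply/seteqP; split=> w; rewrite /void /= => h.
  case: h => /asboolPn hA /asboolPn hB; apply/asboolPn => -[q [Pq q0 [Aq|Bq]]].
    by apply: hA; exists q.
  by apply: hB; exists q.
move/asboolPn: h => h; split; apply/asboolPn => -[q [Pq q0 q1]]; apply: h; exists q.
  by split => //; left.
by split => //; right.
Qed.

Lemma void_indep A B : measurable A -> measurable B -> A `&` B = set0 ->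
  P (void A `&` void B) = (P (void A) * P (void B))%E.
Proof.
move=> mA mB AB; case: hPi => _ _ ind.
pose X (i : 'I_2) := marked (if i == ord0 then A else B).
have := ind 2%N X (fun=> [set 0%E]).
rewrite !big_ord_recl big_ord0 mule1 /X /= -!voidE => <-.
- congr (P _); apply/seteqP; split=> w.
    by rewrite !voidE => -[hA hB] i _; case: (i == ord0).
  move=> h; split; rewrite voidE; first exact: (h ord0).
  exact: (h (lift ord0 ord0)).
- by move=> i; apply: measurable_marked; case: (i == ord0).
- have dis q : A q -> B q -> False.
    by move=> Aq Bq; have : (A `&` B) q by []; rewrite AB.
  apply/trivIsetP => -[[|[|//]] hi] [[|[|//]] hj] _ _ // _; rewrite -subset0;
    by move=> q /= -[[q1 _] [q2 _]]; apply: (dis q).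
- by move=> _; exact: emeasurable_set1.
Qed.

Definition void_past (s : R) : set (set T) :=
  [set void A | A in [set A | measurable A /\ A `<=` [set q | q.1 <= s]]].

Definition void_future (s : R) : set (set T) :=
  [set void A | A in [set A | measurable A /\ A `<=` [set q | s < q.1]]].

(** The avoidance events form a pi-system, on which the hypothesis of
    independence over disjoint sets can be read directly. *)
Lemma past_future_indep s A B : <<s void_past s >> A -> <<s void_future s >> B ->
  P (A `&` B) = (P A * P B)%E.
Proof.
apply: indep_sigma.
- by move=> _ [C [mC _] <-]; exact: measurable_void.
- by move=> _ [C [mC _] <-]; exact: measurable_void.
- move=> _ _ [C [mC Cs] <-] [C' [mC' Cs'] <-]; rewrite voidU; exists (C `|` C') => //.
  by split; [exact: measurableU|move=> q [/Cs|/Cs']].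
- move=> _ _ [C [mC Cs] <-] [C' [mC' Cs'] <-]; rewrite voidU; exists (C `|` C') => //.
  by split; [exact: measurableU|move=> q [/Cs|/Cs']].
- move=> _ _ [C [mC Cs] <-] [C' [mC' Cs'] <-]; apply: void_indep => //.
  by rewrite -subset0 => q [/Cs /= qs /Cs' /=]; rewrite ltNge qs.
Qed.

End PastFuture.
(** * The Markov property *)

Section Markov.
Context d (T : measurableType d) (R : realType) (P : probability T R).
Variables (t0 t1 a0 : R) (Pi : T -> set (measurableTypeR R * measurableTypeR R))
  (F : R -> R -> R).
Hypotheses (hPi : poisson_point_process P (lebesgue_strip t0 t1) Pi)
  (mF : forall v, measurable_fun setT (F v)).

Let Z u w := flow F t0 u (hit (Pi w)) a0.

Hypothesis flowP : forall s t, t0 <= s -> s <= t -> t < t1 ->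
  {ae P, forall w, flow F s t (hit (Pi w)) (Z s w) = Z t w}.

Let hitE A : [set w | hit (Pi w) A] = ~` void Pi A.
Proof.
apply/seteqP; split=> w; rewrite /void /=; last by move=> /negP; rewrite negbK.
by move=> h; apply/negP; rewrite negbK.
Qed.

Lemma measurable_flow_path t : t0 <= t -> measurable_fun setT (Z t).
Proof.
move=> tt; apply: measurable_flow => // A mA _; rewrite hitE.
by apply: measurableC; exact: (measurable_void hPi).
Qed.

Section PresentTime.
Variables (s t : R) (B : set R).
Hypotheses (t0s : t0 <= s) (st : s <= t) (tt1 : t < t1) (mB : measurable B).

Let past := g_sigma_algebraType (void_past Pi s).
Let future := g_sigma_algebraType (void_future Pi s).

Let measurable_past (A : set past) : measurable A -> measurable (A : set T).
Proof.
apply: smallest_sub; first exact: sigma_algebra_measurable.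
by move=> _ [C [mC _] <-]; exact: (measurable_void hPi).
Qed.

Let measurable_future (A : set future) : measurable A -> measurable (A : set T).
Proof.
apply: smallest_sub; first exact: sigma_algebra_measurable.
by move=> _ [C [mC _] <-]; exact: (measurable_void hPi).
Qed.

Let toPast : measurable_fun setT (id : T -> past).
Proof. by move=> _ A mA; rewrite setTI; exact: measurable_past. Qed.

Let toFuture : measurable_fun setT (id : T -> future).
Proof. by move=> _ A mA; rewrite setTI; exact: measurable_future. Qed.

Let measurable_Z_past u : t0 <= u -> u <= s -> measurable_fun setT (Z u : past -> R).
Proof.
move=> t0u us; apply: measurable_flow => // A mA sA; rewrite hitE.
apply: measurableC; apply: sub_sigma_algebra; exists A => //; split => //.
by move=> q /sA /andP[_ /le_trans]; exact.
Qed.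

Let measurable_flow_future d1 (U : measurableType d1) (z : U -> R) :
  measurable_fun setT z ->
  measurable_fun setT
    (fun p : U * future => flow F s t (hit (Pi p.2)) (z p.1)).
Proof.
move=> mz; apply: measurable_flow => //; first exact: measurableT_comp.
move=> A mA sA.
rewrite (_ : [set p | _] = setT `*` (~` void Pi A)).
  apply: measurableX => //; apply: measurableC; apply: sub_sigma_algebra.
  by exists A => //; split => // q /sA /andP[].
apply/seteqP; split=> -[u w] /=; rewrite /void /=; last by move=> [_ /negP]; rewrite negbK.
by move=> h; split => //; apply/negP; rewrite negbK.
Qed.

Let transition z : R := fine (P [set w | B (flow F s t (hit (Pi w)) z)]).

Let measurable_arrival z : measurable [set w | B (flow F s t (hit (Pi w)) z)].
Proof.
rewrite (_ : [set w | _] = (fun w => flow F s t (hit (Pi w)) z) @^-1` B)//.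
rewrite -[X in measurable X]setTI; apply: (measurable_flow (z := fun=> z)) => //.
by move=> A mA _; rewrite hitE; apply: measurableC; exact: (measurable_void hPi).
Qed.

Let transitionE z : P [set w | B (flow F s t (hit (Pi w)) z)] = (transition z)%:E.
Proof. by rewrite /transition fineK// fin_num_measure. Qed.

Let measurable_transition : measurable_fun setT transition.
Proof.
apply: (measurableT_comp (fine_measurable (@measurableT _ (\bar R)))).
pose C := (fun p : R * future => flow F s t (hit (Pi p.2)) p.1) @^-1` B.
have mC : measurable C.
  rewrite -[C]setTI.
  exact: (measurable_flow_future (@measurable_id _ _ setT) measurableT mB).
have := @measurable_prob_xsection _ T R P _ (measurableTypeR R) _ future id C toFuture mC.
congr (measurable_fun _ _); apply/funext => z; congr (P _).
by apply/seteqP; split=> w; rewrite /= /xsection /= inE.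
Qed.

(** The value at [t] is a function of the present state and of the points after
    [s], and the latter are independent of the past. *)
Let transition_past (A : set T) : <<s void_past Pi s >> A ->
  (\int[P]_(w in A) (transition (Z s w))%:E)%E = P (A `&` Z t @^-1` B).
Proof.
move=> pA; have mA : measurable A by exact: measurable_past.
have mZt : measurable (Z t @^-1` B).
  by rewrite -[X in measurable X]setTI; apply: measurable_flow_path => //;
    exact: le_trans st.
pose C := [set p : past * future |
  A p.1 /\ B (flow F s t (hit (Pi p.2)) (Z s p.1))].
have mC : measurable C.
  rewrite (_ : C = (A `*` setT) `&`
    (fun p : past * future => flow F s t (hit (Pi p.2)) (Z s p.1)) @^-1` B).
    apply: measurableI; first exact: measurableX.
    rewrite -[X in measurable X]setTI; apply: measurable_flow_future => //.
    exact: measurable_Z_past.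
  by apply/seteqP; split=> -[u v] /=; [move=> [? ?]|move=> [[? _] ?]].
have ind (A1 : set past) (A2 : set future) : measurable A1 -> measurable A2 ->
    P ((id : T -> past) @^-1` A1 `&` (id : T -> future) @^-1` A2) =
    (P ((id : T -> past) @^-1` A1) * P ((id : T -> future) @^-1` A2))%E.
  exact: (past_future_indep hPi).
have fr := indep_freezing toPast toFuture ind mC.
have mD : measurable ([set w : T | C (w, w)] : set T).
  have mX := measurable_fun_pair toPast toFuture.
  by have := mX measurableT C mC; rewrite setTI.
transitivity (P [set w : T | C (w, w)]); last first.
  apply: probability_ae => //; first exact: measurableI.
  by apply: filterS (flowP t0s st tt1) => w /= e; rewrite /C /= e.
rewrite fr integral_mkcond; apply: eq_integral => w _.
rewrite patchE; case: ifPn => [|]; rewrite ?inE ?notin_setE => Aw.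
  rewrite -transitionE; congr (P _).
  apply/seteqP; split=> v; rewrite /xsection /= inE /C /=; first by [].
  by case.
rewrite (_ : _ @^-1` _ = set0) ?measure0//.
by rewrite -subset0 => v; rewrite /xsection /= inE => -[].
Qed.

Let sigma_rv_past (E : set R) : E `<=` [set u | t0 <= u <= s] ->
  sigma_rv E Z `<=` <<s void_past Pi s >>.
Proof.
move=> Es; apply: smallest_sub; first exact: smallest_sigma_algebra.
move=> _ [u /Es /andP[t0u us]] [A mA <-].
exact: (measurable_Z_past t0u us measurableT mA).
Qed.

Lemma transition_cond_prob (E : set R) : E `<=` [set u | t0 <= u <= s] -> E s ->
  is_cond_prob P (sigma_rv E Z) (Z t @^-1` B) (transition \o Z s).
Proof.
move=> Es s_E; split.
- move=> A mA; apply: sub_sigma_algebra; exists s => //.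
  exists (transition @^-1` A); last by rewrite setTI.
  by rewrite -[X in measurable X]setTI; exact: measurable_transition.
- have mh : measurable_fun setT (transition \o Z s).
    exact: (measurableT_comp measurable_transition (measurable_flow_path t0s)).
  apply: measurable_bounded_integrable => //.
    by rewrite [ltLHS]probability_setT ltry.
  exists 1; split => // M M1 w _ /=.
  rewrite (le_trans _ (ltW M1))// ger0_norm -lee_fin -transitionE.
    exact: probability_le1.
  exact: (measure_ge0 P).
- by move=> A GA; apply: transition_past; exact: (sigma_rv_past Es).
Qed.

End PresentTime.

Lemma flow_markov : markov_process P `[t0, t1[%classic Z.
Proof.
split=> [t|s t B]; rewrite /= !in_itv /=.
  by move=> /andP[h _]; exact: measurable_flow_path.
move=> /andP[t0s st1] /andP[t0t tt1] st mB.
eexists; split; apply: (transition_cond_prob t0s st tt1 mB) => //.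
- by move=> u /= []; rewrite in_itv /= => /andP[-> _] ->.
- by split => //=; rewrite in_itv /= t0s st1.
- by move=> u /= ->; rewrite t0s lexx.
Qed.

End Markov.

(** * Existence and approximation of the multistable process *)

Theorem theorem3p1 (R : realType) (d : measure_display) (T : measurableType d)
    (P : probability T R) (t0 t1 a b a0 : R) (alpha : R -> R)
    (Pi : T -> set (measurableTypeR R * measurableTypeR R))
    (ht : t0 < t1) (ha : 0 < a) (hab : a < b) (hb : b < 1)
    (halpha : forall x : R, a <= alpha x <= b)
    (halpha_der : forall x : R, derivable alpha x 1)
    (halpha_C1 : continuous (derive1 alpha))
    (halpha_bnd : exists M : R, forall x : R, `|derive1 alpha x| <= M)
    (hPi_strip : forall w, Pi w `<=` strip t0 t1)
    (hPi : poisson_point_process P (lebesgue_strip t0 t1) Pi) :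
  exists Z : R -> T -> R,
    [/\ markov_process P `[t0, t1[%classic Z,
        {ae P, forall w, [/\ cadlag t0 t1 (Z ^~ w), Z t0 w = a0 &
                             jump_equation t0 t1 a0 alpha (Pi w) (Z ^~ w)]},
        {ae P, forall w, forall n : nat, exists f : R -> R,
           jump_equation t0 t1 a0 alpha
             (Pi w `&` [set p | `|p.2| <= n%:R]) f} &
        forall Zn : nat -> R -> T -> R,
          {ae P, forall w, forall n : nat,
             jump_equation t0 t1 a0 alpha
               (Pi w `&` [set p | `|p.2| <= n%:R]) (Zn n ^~ w)} ->
          {ae P, forall w,
             sup_norm t0 t1 (fun t => Zn n t w - Z t w) @[n --> \oo]
               --> 0%E}].
Proof.
have [D [D00 D0 anti sD [AD AL]]] :=
  amplitude_majorant ha hab hb halpha halpha_der halpha_bnd.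
pose F := amplitude alpha.
have F0 z : F 0 z = 0 by exact: amplitude0.
have Fc u z : u != 0 -> F v z @[v --> u] --> F u z.
  by move=> u0; exact: continuous_signed_pow.
have mF v : measurable_fun setT (F v).
  apply: continuous_measurable_fun => z.
  have c : D v * `|z' - z| @[z' --> z] --> 0.
    have h : z' - z @[z' --> z] --> z - z by apply: cvgB; [exact: cvg_id|exact: cvg_cst].
    by rewrite -(mulr0 (D v)) -(normr0 R) -(subrr z); apply: cvgMr; exact: cvg_norm.
  apply/cvgrPdist_le => e e0; have /cvgrPdist_le/(_ _ e0) := c.
  apply: filterS => z'; rewrite sub0r normrN => h; rewrite distrC.
  by apply: le_trans h; apply: le_trans (AL _ _ _) (ler_norm _).
pose Z u w := flow F t0 u (hit (Pi w)) a0.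
pose mid := (t0 + t1) / 2.
have mid01 : t0 < mid < t1 by rewrite /mid; apply/andP; split; lra.
have good : {ae P, forall w, exists x y zeta, [/\ enumerates (Pi w) x y,
    asum (fun i => D (y i)), forall i, t0 < x i < t1,
    jump_solution x (fun i => F (y i)) a0 zeta &
    forall t, t0 <= t -> Z t w = jump_path x (fun i => F (y i)) a0 zeta t]}.
  apply: filterS (poisson_summable ht hPi D00 D0 anti sD) => w Hw.
  have cw : countable (Pi w) by case: hPi.
  have [x [y [Exy x0]]] := enumeration_exists mid cw.
  have aD := Hw x y Exy.
  have xt i : t0 < x i < t1.
    have [y0|y0] := eqVneq (y i) 0; first by rewrite x0.
    by case: Exy => E1 _ _; have [] := hPi_strip _ _ (E1 i y0); rewrite /= in_itv.
  have [zeta zP] := jump_solution_exists x (fun i => D0 (y i)) aD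
    (fun i => AD (y i)) (fun i => AL (y i)) a0.
  exists x, y, zeta; split => // t t0t; rewrite /Z.
  rewrite -(flow_jump_path Exy D0 aD F0 AD AL anti Fc zP t0t).
  by rewrite jump_path_start// => i; case/andP: (xt i).
exists Z; split.
- apply: flow_markov => // s t t0s st tt1.
  apply: filterS good => w [x [y [zeta [Exy aD xt zP ZE]]]].
  rewrite -/(Z s w) -/(Z t w) ZE// ZE ?(le_trans t0s)//.
  exact: (flow_jump_path Exy D0 aD F0 AD AL anti Fc zP st).
- apply: filterS good => w [x [y [zeta [Exy aD xt zP ZE]]]].
  have ZE' t : t0 <= t < t1 -> Z t w = jump_path x (fun i => F (y i)) a0 zeta t.
    by move=> /andP[h _]; exact: ZE.
  split.
  + exact: (jump_path_cadlag AD aD ZE').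
  + by rewrite ZE// jump_path_start// => i; case/andP: (xt i).
  + exact: (jump_path_equation AD Exy aD xt zP ZE').
- apply: filterS good => w [x [y [zeta [Exy aD xt zP ZE]]]] n.
  exact: (jump_equation_exists a0 D0 AD AL (enumerates_trunc n%:R Exy)
    (@asum_trunc _ _ D0 D00 _ aD n) xt).
- move=> Zn hZn; apply: filterS2 good hZn.
  move=> w [x [y [zeta [Exy aD xt zP ZE]]]] hn.
  apply: (truncation_cvg D0 D00 AD AL Exy aD xt zP ht (f := fun n t => Zn n t w)
    (g := fun t => Z t w)) => // t /andP[h _]; exact: ZE.
Qed.
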